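(* Let $\mathcal{D}$ be a balanced quadriculated disk containing a domino $d$ such that $\mathcal{D}\smallsetminus d$ is not connected. Suppose that there exists a $2\times2$ square contained in $\mathcal{D}$ which contains $d$. If every connected component of $\mathcal{D}\smallsetminus d$ which intersects a $2\times2$ square that is contained in $\mathcal{D}$ and contains $d$ has size at most $\frac{|\mathcal{D}|-2}{2}$, then $\mathcal{D}$ is strongly irregular.
   Context: A quadriculated disk $\mathcal{D}\subset\mathbb{R}^2$ is a finite union of closed unit squares with vertices in $\mathbb{Z}^2$ that is homeomorphic to a closed disk. The unit square $[a,a+1]\times[b,b+1]$, $(a,b)\in\mathbb{Z}^2$, is white if $a+b$ is even and black if $a+b$ is odd. Two unit squares are adjacent if they share an edge; a (planar) domino is a union of two adjacent unit squares. A $2\times2$ square means a union of four unit squares of the form $[a,a+2]\times[b,b+2]$, $(a,b)\in\mathbb{Z}^2$. $\mathcal{D}$ is balanced if it contains equally many white and black unit squares. The size $|\cdot|$ of a union of unit squares is its number of unit squares. Connected components of $\mathcal{D}\smallsetminus d$ are identified with the corresponding sets of unit squares (connected via shared edges); such a component intersects a $2\times 2$ square if they have a unit square in common. Domino group. A plug is a union $p\subseteq\mathcal{D}$ of unit squares of $\mathcal{D}$ with equally many white and black squares; $\mathbf{p}_\circ=\emptyset$ is the empty plug. Two plugs are disjoint if their interiors are disjoint. The 2-complex $\mathcal{C}_{\mathcal{D}}$ is defined as follows. - Vertices: the plugs. - Edges: for every two distinct disjoint plugs $p_1,p_2$, one edge between $p_1$ and $p_2$ for each planar domino tiling of $\mathcal{D}\smallsetminus\mathrm{int}(p_1\cup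 p_2)$ (the empty region has exactly one tiling, the empty one); also one loop at $\mathbf{p}_\circ$ for each planar domino tiling of $\mathcal{D}$. - 2-cells: (i) for each loop $f$, a disk attached along $f*f$ (so that a projective plane results); (ii) for each two edges joining the same two distinct plugs whose tilings differ by a single planar flip (replacing two parallel dominoes forming a $2\times2$ square by the other two), a disk attached along the resulting bigon; (iii) for each four plugs $p_1,p_2,p_3,p_4$ with $p_2$ disjoint from $p_1$ and from $p_4$, and $p_2=p_3\cup d'$ where $d'$ is a domino whose two unit squares are not in $p_3$, and for each tiling $f_1^*$ of $\mathcal{D}\smallsetminus\mathrm{int}(p_1\cup p_2)$ and each tiling $f_2^*$ of $\mathcal{D}\smallsetminus\mathrm{int}(p_2\cup p_4)$, a disk attached along the quadrilateral $p_1\to p_2\to p_4\to p_3\to p_1$ with edges $f_1^*$, $f_2^*$, $f_2^*\cup\{d'\}$, $f_1^*\cup\{d'\}$. The domino group is $G_{\mathcal{D}}=\pi_1(\mathcal{C}_{\mathcal{D}},\mathbf{p}_\circ)$. The even domino group $G_{\mathcal{D}}^+$ is the kernel of the homomorphism $G_{\mathcal{D}}\to\mathbb{Z}/(2)$ sending a closed edge path of length $N$ to $N \bmod 2$. The disk $\mathcal{D}$ is strongly irregular if there exists a surjective homomorphism from $G_{\mathcal{D}}^+$ onto the free group $F_2$ of rank two. *)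

(* Defs.v *)
From HB Require Import structures.
From Stdlib Require Import Relation_Operators.
From mathcomp Require Import all_boot all_order all_algebra finmap generic_quotient.
From mathcomp Require Import all_classical all_reals all_analysis.

Set Implicit Arguments.
Unset Strict Implicit.
Unset Printing Implicit Defensive.
Import Order.TTheory GRing.Theory Num.Theory numFieldNormedType.Exports.

Local Open Scope quotient_scope.
Local Open Scope classical_set_scope.
Local Open Scope fset_scope.
Local Open Scope ring_scope.

(** * Edge-path groups of 2-complexes *)

Fixpoint walk_along (V E : Type) (o t : E -> V)
    (x : V) (w : seq E) (y : V) : Prop :=
  if w is e :: w' then o e = x /\ walk_along o t (t e) w' y else x = y.

(* A graph in the sense of Serre (every edge gives two mutually opposite darts,
   also when it is a loop) with a disk attached along each circuit in [face]. *)
Record complex2 := Complex2 {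
  vertex : Type;
  dart : Type;
  origin : dart -> vertex;
  target : dart -> vertex;
  opp : dart -> dart;
  face : seq dart -> Prop;
  oppK : involutive opp;
  opp_neq : forall e, opp e <> e;
  origin_opp : forall e, origin (opp e) = target e;
  face_closed : forall c, face c -> exists x, walk_along origin target x c x }.

Section EdgePathGroup.
Variable K : complex2.

Notation walk := (walk_along (@origin K) (@target K)).

Variant elementary : seq (dart K) -> seq (dart K) -> Prop :=
| Backtrack u e v : elementary (u ++ [:: e; opp e] ++ v) (u ++ v)
| Collapse u c v of face c : elementary (u ++ c ++ v) (u ++ v).

Variable x : vertex K.

Record edge_loop := EdgeLoop {
  loop_word :> seq (dart K);
  loop_wordP : walk x loop_word x }.

HB.instance Definition _ := gen_eqMixin edge_loop.
HB.instance Definition _ := gen_choiceMixin edge_loop.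

Definition homotopic : edge_loop -> edge_loop -> Prop :=
  clos_refl_sym_trans edge_loop (fun p q => elementary p q).

Definition homotopicb (p q : edge_loop) : bool := `[< homotopic p q >].

Lemma homotopicb_refl : reflexive homotopicb.
Proof. by move=> p; apply/asboolP; exact: rst_refl. Qed.

Lemma homotopicb_sym : symmetric homotopicb.
Proof.
by move=> p q; apply/asboolP/asboolP => ?; exact: rst_sym.
Qed.

Lemma homotopicb_trans : transitive homotopicb.
Proof.
move=> q p r /asboolP pq /asboolP qr; apply/asboolP.
exact: rst_trans pq qr.
Qed.

Canonical homotopicb_equiv :=
  EquivRel homotopicb homotopicb_refl homotopicb_sym homotopicb_trans.

(* The fundamental group of the cell complex [K] at [x], presented as the
   edge-path group: closed edge paths up to backtracking and boundaries of
   2-cells, multiplied by concatenation. *)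
Definition pi1 := {eq_quot homotopicb}.
HB.instance Definition _ := Choice.on pi1.
HB.instance Definition _ := EqQuotient.on pi1.

Lemma edge_loop_inj (p q : edge_loop) : loop_word p = loop_word q -> p = q.
Proof.
by case: p q => [u hu] [v hv] /= uv; case: _ / uv hv => hv;
  congr EdgeLoop; exact: Prop_irrelevance.
Qed.

Lemma pi1P (p q : edge_loop) :
  reflect (homotopic p q) (\pi_pi1 p == \pi_pi1 q).
Proof. by rewrite eqmodE; exact: asboolP. Qed.

Lemma walk_cat y z t u v : walk y u z -> walk z v t -> walk y (u ++ v) t.
Proof.
elim: u y => [|e u IH] y /=; first by move=> ->.
by move=> [? uz] vt; split => //; exact: IH.
Qed.

Lemma target_opp (e : dart K) : target (opp e) = origin e.
Proof. by rewrite -origin_opp oppK. Qed.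

Definition inv_word (w : seq (dart K)) := rev (map (@opp K) w).

Lemma walk_inv y z w : walk y w z -> walk z (inv_word w) y.
Proof.
elim: w y => [|e w IH] y /=; first by move=> ->.
move=> [<- /IH wz]; rewrite /inv_word /= rev_cons -cats1.
by apply: walk_cat wz _; rewrite /= origin_opp target_opp.
Qed.

Definition loop_one := @EdgeLoop [::] erefl.
Definition loop_mul (p q : edge_loop) :=
  EdgeLoop (walk_cat (loop_wordP p) (loop_wordP q)).
Definition loop_inv (p : edge_loop) := EdgeLoop (walk_inv (loop_wordP p)).

Lemma homotopic_mul p p' q q' : homotopic p p' -> homotopic q q' ->
  homotopic (loop_mul p q) (loop_mul p' q').
Proof.
move=> pp' qq'; apply: (@rst_trans _ _ _ (loop_mul p' q)).
  elim: pp' => [{}p {}p' pp'|{}p|{}p {}p' _|{}p p2 {}p' _ + _].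
  - apply: rst_step => /=; case: pp' => [u e v|u c v cf] /=.
    + by rewrite -!catA; exact: Backtrack.
    + by rewrite -!catA; exact: Collapse.
  - exact: rst_refl.
  - exact: rst_sym.
  - exact: rst_trans.
elim: qq' => [{}q {}q' qq'|{}q|{}q {}q' _|{}q q2 {}q' _ + _].
- apply: rst_step => /=; case: qq' => [u e v|u c v cf] /=.
  + by rewrite catA [p' ++ (_ ++ _)]catA; exact: Backtrack.
  + by rewrite catA [p' ++ (_ ++ _)]catA; exact: Collapse.
- exact: rst_refl.
- exact: rst_sym.
- exact: rst_trans.
Qed.

Lemma inv_wordK : involutive inv_word.
Proof. by move=> w; rewrite /inv_word map_rev revK mapK //; exact: oppK. Qed.

Lemma homotopic_mulV p : homotopic (loop_mul p (loop_inv p)) loop_one.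
Proof.
suff H z : forall (w : seq (dart K)) (hw : walk x w z) (q : edge_loop),
    loop_word q = w ++ inv_word w -> homotopic q loop_one.
  exact: (H x _ (loop_wordP p)).
move=> w; elim/last_ind: w z => [|w e IH] z hw q qE.
  rewrite (_ : q = loop_one); first exact: rst_refl.
  exact: edge_loop_inj.
have [y hwy] : exists y, walk x w y.
  elim: w {IH q qE} x hw => [|f w IH] x' /=; first by exists x'.
  by move=> [? /IH[y ?]]; exists y.
have hq : walk x (w ++ inv_word w) x by exact: walk_cat hwy (walk_inv hwy).
apply: (@rst_trans _ _ _ (EdgeLoop hq)); last exact: (IH _ hwy).
apply: rst_step; rewrite qE /= /inv_word map_rcons rev_rcons -cats1 -catA.
exact: (Backtrack w e).
Qed.

Lemma loop_invK : involutive loop_inv.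
Proof. by move=> p; apply: edge_loop_inj; exact: inv_wordK. Qed.

Lemma homotopic_Vmul p : homotopic (loop_mul (loop_inv p) p) loop_one.
Proof. by rewrite -{2}[p]loop_invK; exact: homotopic_mulV. Qed.

Definition pi1_one : pi1 := \pi_pi1 loop_one.
Definition pi1_mul (a b : pi1) : pi1 := \pi_pi1 (loop_mul (repr a) (repr b)).
Definition pi1_inv (a : pi1) : pi1 := \pi_pi1 (loop_inv (repr a)).

Lemma repr_pi p : homotopic (repr (\pi_pi1 p)) p.
Proof. by apply/pi1P; rewrite reprK. Qed.

Lemma pi1_mulE p q : pi1_mul (\pi_pi1 p) (\pi_pi1 q) = \pi_pi1 (loop_mul p q).
Proof. by apply/eqP/pi1P; apply: homotopic_mul; exact: repr_pi. Qed.

Lemma pi1_mulA : associative pi1_mul.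
Proof.
elim/quotW=> a; elim/quotW=> b; elim/quotW=> c.
rewrite (pi1_mulE b c) (pi1_mulE a) (pi1_mulE a b) (pi1_mulE _ c).
by congr (\pi_pi1 _); apply: edge_loop_inj; rewrite /= catA.
Qed.

Lemma pi1_mul1 : left_id pi1_one pi1_mul.
Proof.
elim/quotW=> a; rewrite (pi1_mulE _ a).
by congr (\pi_pi1 _); exact: edge_loop_inj.
Qed.

Lemma pi1_1mul : right_id pi1_one pi1_mul.
Proof.
elim/quotW=> a; rewrite (pi1_mulE a).
by congr (\pi_pi1 _); apply: edge_loop_inj; rewrite /= cats0.
Qed.

Lemma pi1_mulV : left_inverse pi1_one pi1_inv pi1_mul.
Proof.
move=> a; rewrite -[X in pi1_mul _ X]reprK [LHS]pi1_mulE.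
by apply/eqP/pi1P; exact: homotopic_Vmul.
Qed.

Lemma pi1_Vmul : right_inverse pi1_one pi1_inv pi1_mul.
Proof.
move=> a; rewrite -[X in pi1_mul X _]reprK [LHS]pi1_mulE.
by apply/eqP/pi1P; exact: homotopic_mulV.
Qed.

HB.instance Definition _ :=
  isGroup.Build pi1 pi1_mulA pi1_mul1 pi1_1mul pi1_mulV pi1_Vmul.

End EdgePathGroup.

Arguments edge_loop {K} x.
Arguments pi1 K x : clear implicits.

(** * Free groups *)

Section FreeGroup.
Variable I : choiceType.

(* [(i, true)] is the generator [i] and [(i, false)] is its inverse. *)
Notation letter := (I * bool)%type.
Implicit Types (l : letter) (w : seq letter).

Definition letter_inv l : letter := (l.1, ~~ l.2).

Definition reduced w : bool := sorted (fun l l' => l' != letter_inv l) w.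

Record free_group := FreeWord {
  free_word :> seq letter;
  free_wordP : reduced free_word }.

HB.instance Definition _ := [isSub for free_word].
HB.instance Definition _ := [Choice of free_group by <:].

Definition push l w : seq letter :=
  if w is l' :: w' then if l' == letter_inv l then w' else l :: w else [:: l].

(* The reduced form of the concatenation of [w] and [w']. *)
Definition cat_reduce w w' : seq letter := foldr push w' w.

Lemma letter_invK : involutive letter_inv.
Proof. by case=> i b; rewrite /letter_inv /= negbK. Qed.

Lemma reduced_push l w : reduced w -> reduced (push l w).
Proof.
case: w => [//|l' w] /= h; case: ifPn => [_|ll'] /=; first exact: path_sorted h.
by rewrite ll'.
Qed.

Lemma reduced_cat_reduce w w' : reduced w' -> reduced (cat_reduce w w').
Proof. by move=> h; elim: w => //= l w; exact: reduced_push. Qed.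

Lemma push_inv l w : reduced w -> push l (push (letter_inv l) w) = w.
Proof.
case: w => [|l' w] /=; first by rewrite eqxx.
rewrite letter_invK; case: eqP => [-> {l'}|_ _] /=; last by rewrite eqxx.
by case: w => [//|l' w] /= /andP[/negPf -> _].
Qed.

Lemma cat_reduce_push l w w' : reduced w' ->
  cat_reduce (push l w) w' = push l (cat_reduce w w').
Proof.
move=> h; case: w => [//|l' w] /=; case: eqP => [->|//].
by rewrite push_inv //; exact: reduced_cat_reduce.
Qed.

Lemma cat_reduceA w1 w2 w3 : reduced w3 ->
  cat_reduce w1 (cat_reduce w2 w3) = cat_reduce (cat_reduce w1 w2) w3.
Proof.
by move=> h; elim: w1 => //= l w1 ->; rewrite cat_reduce_push.
Qed.

Lemma cat_reduce0 w : reduced w -> cat_reduce w [::] = w.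
Proof.
elim: w => //= l w IH h; rewrite IH; last exact: path_sorted h.
by case: w h {IH} => //= l' w /andP[/negPf -> _].
Qed.

Definition free_inv_word w := rev (map letter_inv w).

Lemma reduced_inv w : reduced w -> reduced (free_inv_word w).
Proof.
rewrite /reduced rev_sorted sorted_map; apply: sub_sorted => l l' /=.
by rewrite letter_invK eq_sym.
Qed.

Lemma cat_reduceV w : cat_reduce (free_inv_word w) w = [::].
Proof.
elim: w => //= l w IH; rewrite /free_inv_word /= rev_cons /cat_reduce.
by rewrite foldr_rcons /= letter_invK eqxx.
Qed.

Lemma free_inv_wordK : involutive free_inv_word.
Proof.
by move=> w; rewrite /free_inv_word map_rev revK mapK //; exact: letter_invK.
Qed.

Definition free_one := @FreeWord [::] isT.
Definition free_mul (a b : free_group) :=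
  FreeWord (reduced_cat_reduce a (free_wordP b)).
Definition free_inv (a : free_group) := FreeWord (reduced_inv (free_wordP a)).

Lemma free_mulA : associative free_mul.
Proof.
by move=> a b c; apply: val_inj; apply: cat_reduceA; exact: free_wordP.
Qed.

Lemma free_mul1 : left_id free_one free_mul.
Proof. by move=> a; exact: val_inj. Qed.

Lemma free_1mul : right_id free_one free_mul.
Proof. by move=> a; apply: val_inj; apply: cat_reduce0; exact: free_wordP. Qed.

Lemma free_mulV : left_inverse free_one free_inv free_mul.
Proof. by move=> a; apply: val_inj; exact: cat_reduceV. Qed.

Lemma free_Vmul : right_inverse free_one free_inv free_mul.
Proof.
by move=> a; apply: val_inj; rewrite /= -{1}[free_word a]free_inv_wordK cat_reduceV.
Qed.

HB.instance Definition _ :=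
  isGroup.Build free_group free_mulA free_mul1 free_1mul free_mulV free_Vmul.

End FreeGroup.

(** * Quadriculated regions *)

(* [(a, b)] stands for the closed unit square [a, a+1] x [b, b+1]. *)
Definition square := (int * int)%type.
Implicit Types (s : square) (X d p : {fset square}) (t : {fset {fset square}}).

Definition white s : bool := (2 %| (s.1 + s.2)%R)%Z.

Definition square_adjacent s s' : bool := `|s.1 - s'.1| + `|s.2 - s'.2| == 1.

Definition is_domino d : Prop :=
  exists s s', square_adjacent s s' /\ d = [fset s; s'].

Definition block s : {fset square} :=
  [fset s; (s.1 + 1, s.2); (s.1, s.2 + 1); (s.1 + 1, s.2 + 1)].

Definition balanced X : bool :=
  #|` [fset s in X | white s]| == #|` [fset s in X | ~~ white s]|.

Definition region (R : realType) X : set (R * R) :=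
  [set z | exists2 s, s \in X &
     s.1%:~R <= z.1 <= s.1%:~R + 1 /\ s.2%:~R <= z.2 <= s.2%:~R + 1].

Definition homeomorphic (T U : topologicalType) (A : set T) (B : set U) : Prop :=
  exists (f : T -> U) (g : U -> T),
    [/\ {within A, continuous f}, {within B, continuous g},
        forall x, A x -> B (f x) /\ g (f x) = x &
        forall y, B y -> A (g y) /\ f (g y) = y].

Definition closed_disk (R : realType) : set (R * R) :=
  [set z | z.1 ^+ 2 + z.2 ^+ 2 <= 1].

Definition quadriculated_disk (R : realType) X : Prop :=
  homeomorphic (@region R X) (@closed_disk R).

Definition linked X : rel X :=
  connect (fun s s' : X => square_adjacent (val s) (val s')).

(* For [X = D `\` d], removing the closed domino [d] from the disk [D] leaves a
   set whose connected components are represented by these classes of squares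
   connected via shared edges. *)
Definition disconnected X : Prop := exists s s' : X, ~~ linked s s'.

Definition component X (c : {fset square}) : Prop :=
  exists s : X, c = [fset val s' | s' in linked s].

(** * The domino group *)

Definition tiling X t : Prop :=
  [/\ forall d, d \in t -> is_domino d, trivIfset t & fcover t = X].

Definition horizontal_pair s : {fset {fset square}} :=
  [fset [fset s; (s.1 + 1, s.2)]; [fset (s.1, s.2 + 1); (s.1 + 1, s.2 + 1)]].

Definition vertical_pair s : {fset {fset square}} :=
  [fset [fset s; (s.1, s.2 + 1)]; [fset (s.1 + 1, s.2); (s.1 + 1, s.2 + 1)]].

Definition flip t t' : Prop := exists s,
  (horizontal_pair s `<=` t /\
     t' = (t `\` horizontal_pair s) `|` vertical_pair s) \/
  (vertical_pair s `<=` t /\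
     t' = (t `\` vertical_pair s) `|` horizontal_pair s).

Section DominoComplex.
Variable D : {fset square}.

Record plug := Plug {
  plug_squares :> {fset square};
  plugP : (plug_squares `<=` D) && balanced plug_squares }.

HB.instance Definition _ := [isSub for plug_squares].
HB.instance Definition _ := [Choice of plug by <:].

Lemma empty_plugP : (fset0 `<=` D) && balanced fset0.
Proof.
rewrite fsub0set /= /balanced; apply/eqP; congr #|` _|.
by apply/fsetP => s; rewrite !inE.
Qed.

Definition empty_plug : plug := Plug empty_plugP.

Inductive domino_dart :=
| PlugDart (p q : plug) (t : {fset {fset square}}) of
    p != q & [disjoint p & q] & tiling (D `\` (p `|` q)) t
| LoopDart (t : {fset {fset square}}) of tiling D t & bool.

Definition dart_origin (e : domino_dart) : plug :=
  match e with PlugDart p _ _ _ _ _ => p | LoopDart _ _ _ => empty_plug end.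

Definition dart_target (e : domino_dart) : plug :=
  match e with PlugDart _ q _ _ _ _ => q | LoopDart _ _ _ => empty_plug end.

Definition dart_tiling (e : domino_dart) : {fset {fset square}} :=
  match e with PlugDart _ _ t _ _ _ => t | LoopDart t _ _ => t end.

Lemma swap_neq (p q : plug) : p != q -> q != p.
Proof. by rewrite eq_sym. Qed.

Lemma swap_disjoint (p q : plug) : [disjoint p & q] -> [disjoint q & p].
Proof. by rewrite fdisjoint_sym. Qed.

Lemma swap_tiling (p q : plug) t :
  tiling (D `\` (p `|` q)) t -> tiling (D `\` (q `|` p)) t.
Proof. by rewrite fsetUC. Qed.

Definition dart_opp (e : domino_dart) : domino_dart :=
  match e with
  | PlugDart p q t pq dpq ht =>
      PlugDart (swap_neq pq) (swap_disjoint dpq) (swap_tiling ht)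
  | LoopDart t ht b => LoopDart ht (~~ b)
  end.

(* In the last case [e4] (or [e3]) is a loop when [p1] (or [p4]) and [p3] are
   empty; both of its orientations are allowed, which is harmless in view of the
   first case. *)
Inductive domino_face : seq domino_dart -> Prop :=
| LoopFace t (ht : tiling D t) b :
    domino_face [:: LoopDart ht b; LoopDart ht b]
| FlipFace e e' of
    dart_origin e = dart_origin e' & dart_target e = dart_target e' &
    dart_origin e != dart_target e & flip (dart_tiling e) (dart_tiling e') :
    domino_face [:: e; dart_opp e']
| SlideFace (p1 p2 p3 p4 : plug) d (e1 e2 e3 e4 : domino_dart) of
    is_domino d & [disjoint d & p3] & p2 = p3 `|` d :> {fset square} &
    dart_origin e1 = p1 /\ dart_target e1 = p2 &
    dart_origin e2 = p2 /\ dart_target e2 = p4 &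
    dart_origin e3 = p4 /\ dart_target e3 = p3 &
    dart_origin e4 = p3 /\ dart_target e4 = p1 &
    dart_tiling e3 = d |` dart_tiling e2 &
    dart_tiling e4 = d |` dart_tiling e1 :
    domino_face [:: e1; e2; e3; e4].

Lemma dart_oppK : involutive dart_opp.
Proof.
case=> [p q t pq dpq ht|t ht b] /=; last by rewrite negbK.
by congr PlugDart; exact: Prop_irrelevance.
Qed.

Lemma dart_opp_neq (e : domino_dart) : dart_opp e <> e.
Proof.
case: e => [p q t pq dpq ht|t ht b] /=; last by case: b => -[].
by case=> qp _; rewrite qp eqxx in pq.
Qed.

Lemma dart_origin_opp (e : domino_dart) : dart_origin (dart_opp e) = dart_target e.
Proof. by case: e. Qed.

Lemma dart_target_opp (e : domino_dart) : dart_target (dart_opp e) = dart_origin e.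
Proof. by case: e. Qed.

Lemma domino_face_closed (c : seq domino_dart) : domino_face c ->
  exists x, walk_along dart_origin dart_target x c x.
Proof.
case=> [t ht b|e e' oE tE _ _|p1 p2 p3 p4 d e1 e2 e3 e4 _ _ _].
- by exists empty_plug.
- by exists (dart_origin e); rewrite /= dart_origin_opp dart_target_opp oE tE.
- by move=> [? ?] [? ?] [? ?] [? ?] _ _; exists p1; do ![split; try congruence].
Qed.

Definition domino_complex : complex2 :=
  Complex2 dart_oppK dart_opp_neq dart_origin_opp domino_face_closed.

Definition domino_group := pi1 domino_complex empty_plug.
HB.instance Definition _ := monoid.Group.on domino_group.

Lemma odd_homotopic (a b : edge_loop (empty_plug : vertex domino_complex)) :
  homotopic a b -> odd (size a) = odd (size b).
Proof.
elim=> [{}a {}b ab|//|//|{}a c {}b _ -> _ ->//].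
case: ab => [u e v|u c v cf]; first by rewrite !size_cat /= !oddD.
rewrite !size_cat !oddD (_ : odd (size c) = false) //.
by case: cf.
Qed.

Definition length_mod2 (g : domino_group) : 'Z_2 :=
  (size (loop_word (repr g)))%:R.

Lemma natZ2_odd n : n%:R = (odd n)%:R :> 'Z_2.
Proof. by rewrite -[LHS]Zp_nat_mod // modn2. Qed.

Lemma length_mod2E (a : edge_loop (empty_plug : vertex domino_complex)) :
  length_mod2 (\pi_(domino_group) a) = (size a)%:R.
Proof.
by rewrite /length_mod2 natZ2_odd [RHS]natZ2_odd (odd_homotopic (repr_pi a)).
Qed.

(* The group law of ['Z_2] is its addition. *)
Lemma length_mod2_morphism : monoid.monoid_morphism length_mod2.
Proof.
split=> [|g h]; first by rewrite [LHS]length_mod2E.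
by rewrite [LHS]length_mod2E /= size_cat natrD.
Qed.

HB.instance Definition _ := monoid.isUMagmaMorphism.Build domino_group 'Z_2
  length_mod2 length_mod2_morphism.

Definition even_elements : {pred domino_group} :=
  [pred g | length_mod2 g == 1%g].

Lemma even_elements_group_closed : group_closed even_elements.
Proof.
split=> [|g h]; rewrite !inE; first by rewrite gmulf1.
by move=> /eqP gE /eqP hE; rewrite gmulfF /= gE hE divgg.
Qed.

Record even_domino_group := EvenElement {
  even_val :> domino_group;
  even_valP : even_val \in even_elements }.

HB.instance Definition _ := [isSub for even_val].
HB.instance Definition _ := [Choice of even_domino_group by <:].
HB.instance Definition _ := SubChoice_isSubGroup.Build domino_group
  even_elements even_domino_group even_elements_group_closed.

Definition strongly_irregular : Prop :=
  exists phi : {multiplicative even_domino_group -> free_group 'I_2},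
    forall y, exists x, phi x = y.

End DominoComplex.

(* Main.v *)
From HB Require Import structures.
Require Import Defs.
From mathcomp Require Import all_boot all_order all_algebra finmap generic_quotient.
From mathcomp Require Import all_classical all_reals all_analysis.
From mathcomp Require Import zify ring lra.

(* Let [C] be the union of the components of [D `\` d] meeting a block that
   contains [d]; there are at most two. Colour [C] by white and black, exchanging
   the colours on the second component, and let [Z], [Z'] be the two classes.
   Consider a floor whose tiling contains [d]. If its lower plug meets [C] in [Z],
   then no tile other than [d] fits in the remaining part [Z'] of [C], so that the
   upper plug meets [C] in [Z'], and [d] cannot be flipped. Hence such floors can be
   given independent labels: a floor in even position from [p] to [q] is labelled
   by a generator [a] of [F_2] if [p] meets [C] in [Z], by [b] if in [Z'], and
   trivially otherwise; a floor in odd position gets the inverse of the label of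
   the reversed floor. This is compatible with all 2-cells and defines a
   homomorphism from the even domino group to [F_2].

   The size condition is what allows [Z] to be completed, outside [C] and [d], to a
   balanced plug, and likewise [Z']. Since [D] is edge-connected (a closed disk
   minus finitely many points is connected), every plug can be joined to the empty
   one by an even walk with trivial label: adding a domino [e] to a plug is a walk
   of length two, trivially labelled when [e] differs from [d], and [d] can
   be added by using the other dominoes of a block. Adding [d] directly to a plug
   meeting [C] in [Z] or [Z'] therefore realises each of the two generators. *)

Set Implicit Arguments.
Unset Strict Implicit.
Unset Printing Implicit Defensive.
Import Order.TTheory GRing.Theory Num.Theory numFieldNormedType.Exports.

Local Open Scope quotient_scope.
Local Open Scope classical_set_scope.
Local Open Scope ring_scope.

(** * Edge-connectedness of disks *)

Section PlaneSeparation.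
Variable R : realType.
Implicit Types (z w x : R * R) (t : R) (A K : set (R * R)).

(** Disjointness on [A] makes the trace of [K1] equal to that of the complement of [K2], so this
    trace is both closed and open in [A]. *)
Lemma connected_closed_cover (A K1 K2 : set (R * R)) :
  connected A -> closed K1 -> closed K2 -> A `<=` K1 `|` K2 ->
  A `&` (K1 `&` K2) = set0 -> A `&` K1 !=set0 -> A `<=` K1.
Proof.
move=> cA cK1 cK2 A12 A0 AK1.
have oK2 : A `&` K1 = A `&` ~` K2.
  apply/seteqP; split=> x [Ax K1x]; split => //.
    by move=> K2x; have : set0 x by rewrite -A0.
  by case: (A12 _ Ax).
have <- : A `&` K1 = A.
  apply: cA => //; last by exists K1.
  by exists (~` K2) => //; exact: closed_openC.
exact: subIsetr.
Qed.

Definition chord z w t : R * R :=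
  (z.1 + t * (w.1 - z.1), z.2 + t * (w.2 - z.2)).

Lemma chord_continuous z w : continuous (chord z w).
Proof.
move=> t; apply: (@cvg_pair _ _ _ _ (nbhs (z.1 + t * (w.1 - z.1)))
  (nbhs (z.2 + t * (w.2 - z.2)))) => /=; apply: cvgD; try exact: cvg_cst;
  by apply: cvgM; [exact: cvg_id|exact: cvg_cst].
Qed.

(** Convexity comes from the identity |(1-t)z + tw|^2 = (1-t)|z|^2 + t|w|^2 - t(1-t)|w-z|^2. *)
Lemma chord_disk z w t : closed_disk z -> closed_disk w -> 0 <= t <= 1 ->
  closed_disk (chord z w t).
Proof.
rewrite /closed_disk /= => hz hw ht.
have hs : 0 <= t * (1 - t) by nra.
have : (z.1 + t * (w.1 - z.1)) ^+ 2 + (z.2 + t * (w.2 - z.2)) ^+ 2 =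
  (1 - t) * (z.1 ^+ 2 + z.2 ^+ 2) + t * (w.1 ^+ 2 + w.2 ^+ 2)
  - t * (1 - t) * ((w.1 - z.1) ^+ 2 + (w.2 - z.2) ^+ 2) by ring.
move=> ->.
have := sqr_ge0 (w.1 - z.1); have := sqr_ge0 (w.2 - z.2).
move: ((w.1 - z.1) ^+ 2) ((w.2 - z.2) ^+ 2) => a b a0 b0.
have : 0 <= t * (1 - t) * (b + a) by rewrite mulr_ge0 ?addr_ge0.
nra.
Qed.

(** A curve that meets every line in at most two points; the factor 1/2 keeps it in the disk for [t]
    between 0 and 1. *)
Definition parabola t : R * R := (t / 2%:R, t ^+ 2 / 2%:R).

Lemma parabola_disk t : 0 <= t <= 1 -> closed_disk (parabola t).
Proof.
rewrite /closed_disk /= => ht.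
have : 0 <= t ^+ 2 <= 1 by apply/andP; split; nra.
by rewrite expr_div_n; move: (t ^+ 2) => u; nra.
Qed.

(* The polynomial in [t] vanishing when [parabola t] is on the line through
   [z] and [x]. *)
Definition line_poly z x : {poly R} :=
  ((x.1 - z.1) / 2%:R) *: 'X^2 - ((x.2 - z.2) / 2%:R) *: 'X
  + ((x.2 - z.2) * z.1 - (x.1 - z.1) * z.2)%:P.

Lemma line_poly_neq0 z x : x != z -> line_poly z x != 0.
Proof.
apply: contra => /eqP p0.
have p2 : (line_poly z x)`_2 = (x.1 - z.1) / 2%:R.
  by rewrite /line_poly !coefD coefN !coefZ coefXn coefX coefC /=; ring.
have p1 : (line_poly z x)`_1 = - ((x.2 - z.2) / 2%:R).
  by rewrite /line_poly !coefD coefN !coefZ coefXn coefX coefC /=; ring.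
move: p1 p2; rewrite p0 !coef0 => p1 p2.
have e1 : x.1 = z.1 by lra.
have e2 : x.2 = z.2 by lra.
by rewrite [x]surjective_pairing [z]surjective_pairing e1 e2.
Qed.

Lemma line_poly_chord z x s t : chord z (parabola s) t = x ->
  root (line_poly z x) s.
Proof.
by move=> <-; apply/rootP; rewrite /line_poly !hornerE /=; field.
Qed.

(** The point [w] is taken on the parabola. A parameter is bad only if it is a root of one of
    finitely many nonzero polynomials [line_poly z x], hence of their product. *)
Lemma chord_avoiding (zs : seq (R * R)) (xs : seq (R * R)) :
  {in zs, forall z, z \notin xs} ->
  exists2 w, closed_disk w & {in zs, forall z t, chord z w t \notin xs}.
Proof.
move=> zx.
pose P := \prod_(z <- zs) \prod_(x <- xs) line_poly z x.
have P0 : P != 0.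
  rewrite prodf_seq_neq0; apply/allP => z zz /=.
  rewrite prodf_seq_neq0; apply/allP => x xx /=.
  apply: line_poly_neq0; apply: contraNneq (zx _ zz) => <- //.
(* These are [size P] distinct parameters in ]0, 1], more than the nonzero polynomial [P] can have
   roots. *)
pose ts := [seq k.+1%:R^-1 : R | k <- iota 0 (size P)].
have : ~~ all (root P) ts.
  apply/negP => rP; have := max_poly_roots P0 rP.
  rewrite size_map size_iota ltnn; move/(_ _)/notF; apply.
  rewrite map_inj_uniq ?iota_uniq // => i j /invr_inj/eqP.
  by rewrite eqr_nat eqSS => /eqP.
case/allPn => t /mapP[k _ tE] rP.
exists (parabola t).
  apply: parabola_disk; rewrite tE invr_ge0 ler0n /= invf_le1 ?ltr0n //.
  by rewrite ler1n.
move=> z zz s; apply/negP => cx.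
move: rP; rewrite /P (big_rem z) //= (big_rem (chord z (parabola t) s)) //=.
by rewrite !rootM (line_poly_chord (erefl _)).
Qed.

(* Points of [K1] and [K2] outside [L] are joined to a common point of the disk
   by chords avoiding the image of [L]; each chord stays in its own set. *)
Lemma disk_split (B K1 K2 : set (R * R)) (L : seq (R * R)) :
  homeomorphic B (@closed_disk R) -> closed K1 -> closed K2 ->
  B = K1 `|` K2 -> (forall x, K1 x -> K2 x -> x \in L) ->
  K1 `<=` [set` L] \/ K2 `<=` [set` L].
Proof.
move=> [f [g [_ cg fP gP]]] cK1 cK2 BE K12.
apply: contrapT => /not_orP[].
move=> /existsNP[z1 /not_implyP[Kz1 Lz1]] /existsNP[z2 /not_implyP[Kz2 Lz2]].
have Bz1 : B z1 by rewrite BE; left.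
have Bz2 : B z2 by rewrite BE; right.
(* The points of the closed disk that correspond to the points of [L] in [B]. *)
pose xs := [seq f x | x <- L & `[< B x >]].
have xsP z : B z -> ~ z \in L -> f z \notin xs.
  move=> Bz Lz; apply/negP => /mapP[x]; rewrite mem_filter => /andP[/asboolP Bx Lx].
  move=> /(congr1 g); rewrite (fP _ Bz).2 (fP _ Bx).2 => zx.
  by apply: Lz; rewrite zx.
have [w Dw wP] : exists2 w, closed_disk w &
    {in [:: f z1; f z2], forall z t, chord z w t \notin xs}.
  by apply: chord_avoiding => z; rewrite !inE => /orP[] /eqP ->; exact: xsP.
(* The image under [g] of the chord from [f z] to [w] is connected, starts in [K] and avoids [L], so
   it ends in [K] as well. *)
have side z K K' : B z -> K z -> f z \in [:: f z1; f z2] -> closed K ->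
    closed K' -> B = K `|` K' -> (forall x, K x -> K' x -> x \in L) -> K (g w).
  move=> Bz Kz zin cK cK' BE' KK'.
  have wz : chord (f z) w 1 = w.
    by rewrite /chord !mul1r !subrKC -surjective_pairing.
  have zz : chord (f z) w 0 = f z.
    by rewrite /chord !mul0r !addr0 -surjective_pairing.
  have chordD t : t \in `[0, 1] -> closed_disk (chord (f z) w t).
    by rewrite in_itv => t01; apply: chord_disk => //; exact: (fP _ Bz).1.
  pose I := chord (f z) w @` [set` `[0, 1]].
  have ID : I `<=` closed_disk (R := R) by move=> _ [t /chordD ? <-].
  have cI : connected I.
    apply: connected_continuous_connected; first exact: segment_connected.
    exact/continuous_subspaceT/chord_continuous.
  have cJ : connected (g @` I).
    apply: connected_continuous_connected => //.
    exact: continuous_subspaceW cg.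
  apply: (connected_closed_cover cJ cK cK').
  - by move=> _ [y /ID Dy <-]; rewrite -BE'; exact: (gP _ Dy).1.
  - apply/seteqP; split => // _ [[_ [t t01 <-] <-] [/KK' h /h gL]].
    have [Bg fg] := gP _ (chordD _ t01).
    have /negP := wP _ zin t; apply; rewrite -fg; apply: map_f.
    by rewrite mem_filter gL andbT; exact/asboolP.
  - exists z; split => //; exists (f z); last exact: (fP _ Bz).2.
    by exists 0 => //=; rewrite in_itv /= lexx ler01.
  - by exists w => //; exists 1 => //=; rewrite in_itv /= lexx ler01.
have K1w : K1 (g w) by apply: (side z1 K1 K2) => //; rewrite inE eqxx.
have K2w : K2 (g w).
  apply: (side z2 K2 K1) => //; rewrite ?inE ?eqxx ?orbT //; first by rewrite setUC.
  by move=> x K2x K1x; exact: K12.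
(* The point [g w] is in both sets, hence in [L]; but [w] is itself on a chord avoiding [xs]. *)
have gL := K12 _ K1w K2w; have [Bg fg] := gP _ Dw.
have /negP := wP (f z1) (mem_head _ _) 1; apply.
rewrite /chord !mul1r !subrKC -surjective_pairing -fg; apply: map_f.
by rewrite mem_filter gL andbT; exact/asboolP.
Qed.
End PlaneSeparation.

Local Open Scope fset_scope.
Local Open Scope ring_scope.

Lemma square_adjacent_sym : symmetric square_adjacent.
Proof. by move=> s s'; rewrite /square_adjacent distrC (distrC s.2). Qed.

(** * From the topology of a region to adjacency of its squares *)

Section DiskConnected.
Variable R : realType.
Implicit Types (X : {fset square}).

Lemma closed_region X : closed (@region R X).
Proof.
have -> : @region R X = (\bigcup_(s in [set` X])
    (fst @^-1` `[(s.1%:~R : R), s.1%:~R + 1] `&`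
     snd @^-1` `[(s.2%:~R : R), s.2%:~R + 1]))%classic.
  apply/seteqP; split=> z [s sX].
    by move=> [z1 z2]; exists s => //; split; rewrite /= in_itv /=.
  by move=> []; rewrite /= !in_itv /= => z1 z2; exists s.
apply: closed_bigcup => [|s _]; first exact: finite_fset.
apply: closedI; apply: preimage_closed; try exact: interval_closed.
  by move=> z _; exact: cvg_fst.
by move=> z _; exact: cvg_snd.
Qed.

Definition center (s : square) : R * R :=
  (s.1%:~R + 2%:R^-1, s.2%:~R + 2%:R^-1).

Lemma center_region X s : s \in X -> @region R X (center s).
Proof. by move=> sX; exists s => //=; split; lra. Qed.

(** The lower left vertices of the four squares of [block s] are exactly the four vertices of the
    square [s]. *)
Definition corners X : seq (R * R) :=
  [seq (q.1%:~R, q.2%:~R) | s <- X, q <- block s].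

Lemma center_not_corner X s : center s \notin corners X.
Proof.
apply/negP => /allpairsPdep[s' [q [_ _ [e _]]]].
have : (s.1 * 2 + 1)%:~R = (q.1 * 2)%:~R :> R.
  by rewrite intrD !intrM -e mulrDl mulVf // pnatr_eq0.
by move/intr_inj; lia.
Qed.

Lemma common_coordinate (a b : int) (x : R) :
  a%:~R <= x <= a%:~R + 1 -> b%:~R <= x <= b%:~R + 1 ->
  a = b \/ `|a - b| = 1 /\ (x = a%:~R \/ x = (a + 1)%:~R).
Proof.
move=> ha hb.
have h1 : (a%:~R <= (b + 1)%:~R :> R) by rewrite intrD; lra.
have h2 : (b%:~R <= (a + 1)%:~R :> R) by rewrite intrD; lra.
move: h1 h2; rewrite !ler_int => h1 h2.
have [->|[e|e]] : a = b \/ (b = a - 1 \/ b = a + 1) by lia.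
- by left.
- right; split; first by lia.
  by left; apply: le_anti; move: hb; rewrite e intrB mulr1z subrK; lra.
- right; split; first by lia.
  by right; apply: le_anti; move: ha hb; rewrite e !intrD mulr1z => ha hb; lra.
Qed.

(** If two squares share a point but neither coincide nor share an edge, then both of their
    coordinates differ by one, and the point is a common vertex. *)
Lemma nonadjacent_corner X X' x :
  (forall s s', s \in X -> s' \in X' -> s != s' /\ ~~ square_adjacent s s') ->
  @region R X x -> @region R X' x -> x \in corners X.
Proof.
move=> XX' [s sX [s1 s2]] [s' sX' [s1' s2']].
have [ss' nadj] := XX' _ _ sX sX'.
apply/allpairsPdep; exists s.
have [e1|[e1 x1]] := common_coordinate s1 s1'.
  have [e2|[e2 _]] := common_coordinate s2 s2'.
    by case/eqP: ss'; rewrite [s]surjective_pairing e1 e2 -surjective_pairing.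
  by case/negP: nadj; rewrite /square_adjacent e1 e2 subrr normr0 add0r.
have [e2|[e2 x2]] := common_coordinate s2 s2'.
  by case/negP: nadj; rewrite /square_adjacent e1 e2 subrr normr0 addr0.
suff [q qb xq] : exists2 q, q \in block s & x = (q.1%:~R, q.2%:~R) by exists q.
rewrite [x]surjective_pairing.
case: x1 => ->; case: x2 => ->.
- by exists s; rewrite // !inE eqxx.
- by exists (s.1, s.2 + 1); rewrite // !inE eqxx ?orbT.
- by exists (s.1 + 1, s.2); rewrite // !inE eqxx ?orbT.
- by exists (s.1 + 1, s.2 + 1); rewrite // !inE eqxx ?orbT.
Qed.

(** The class [A] of [s] and its complement [B] in [D] have closed regions meeting only in corners.
    By [disk_split] one of the two regions consists of corners, which the centre of a square never
    is. *)
Lemma quadriculated_disk_linked D : quadriculated_disk R D ->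
  forall s s' : D, linked s s'.
Proof.
move=> diskD s s'; apply/negPn/negP => ss'.
pose A := [fset val u | u in @linked D s].
pose B := D `\` A.
have inA (u : D) : (val u \in A) = linked s u.
  apply/imfsetP/idP => [[v /= sv /val_inj ->] //|su]; by exists u.
have AD : A `<=` D by apply/fsubsetP => _ /imfsetP[u _ ->]; exact: valP.
have AB u v : u \in A -> v \in B -> u != v /\ ~~ square_adjacent u v.
  move=> uA; rewrite inE => /andP[vA vD].
  split; first by apply: contraNneq vA => <-.
  apply: contra vA => uv; have uD := fsubsetP AD _ uA.
  have := inA [` vD]; rewrite /= => ->.
  have := inA [` uD]; rewrite /= uA => /esym su.
  by apply: connect_trans su _; exact: connect1.
have DE : @region R D = (@region R A `|` @region R B)%classic.
  apply/seteqP; split=> x.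
    move=> [u uD hu]; case: (boolP (u \in A)) => uA; [left|right]; exists u => //.
    by rewrite inE uA.
  by case=> -[u]; [move/(fsubsetP AD)|rewrite inE => /andP[_]]; exists u.
have [] := disk_split diskD (@closed_region A) (@closed_region B) DE
  (fun x => @nonadjacent_corner A B x AB).
- have sA : val s \in A by rewrite inA; exact: connect0.
  by move=> /(_ _ (center_region sA)) /=; apply/negP/center_not_corner.
- have sB : val s' \in B by rewrite inE inA ss'; exact: valP.
  by move=> /(_ _ (center_region sB)) /=; apply/negP/center_not_corner.
Qed.
End DiskConnected.

(** * The labelling homomorphism *)

Section FreeGroupGenerators.
Variable I : choiceType.

Definition gen (i : I) : free_group I := @FreeWord _ [:: (i, true)] isT.

Lemma free_group_generated (P : free_group I -> Prop) :
  P 1%g -> (forall a b, P a -> P b -> P (a * b)%g) ->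
  (forall a, P a -> P (a^-1)%g) -> (forall i, P (gen i)) -> forall a, P a.
Proof.
move=> P1 PM PV Pgen [w wP]; elim: w wP => [wP|[i b] w IH wP].
  by rewrite (_ : FreeWord wP = 1%g) //; exact: val_inj.
have wP' : reduced w by exact: path_sorted wP.
pose l := if b then gen i else ((gen i)^-1)%g.
have Pl : P l by rewrite /l; case: b {wP l} => //; exact: PV.
rewrite (_ : FreeWord wP = (l * FreeWord wP')%g); first exact: PM.
apply: val_inj; rewrite -[LHS](cat_reduce0 wP) /= cat_reduce0 //.
by rewrite /l; case: b {wP l Pl}.
Qed.

(** The image of [f] is a subgroup, and the generators are in it. *)
Lemma multiplicative_surjective (G : groupType)
    (f : {multiplicative G -> free_group I}) :
  (forall i, exists g, f g = gen i) -> forall a, exists g, f g = a.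
Proof.
have f1 : f 1%g = 1%g by apply: (mulgI (f 1%g)); rewrite -gmulfM !mulg1.
move=> fgen; apply: free_group_generated => //.
- by exists 1%g.
- by move=> _ _ [g <-] [h <-]; exists (g * h)%g; exact: gmulfM.
- by move=> _ [g <-]; exists (g^-1)%g; apply: (mulgI (f g)); rewrite -gmulfM !mulgV.
Qed.

End FreeGroupGenerators.

(** * Labels of floors and their invariance under homotopy *)

Section Label.
Variables D d : {fset square}.
Implicit Types (p q X Z : {fset square}) (t : {fset {fset square}}) (b : bool).

(** The plugs may coincide here, so that loops at the empty plug are floors like all other darts. *)
Definition floor p q t : Prop := tiling (D `\` (p `|` q)) t /\ [disjoint p & q].

Lemma floorC p q t : floor p q t -> floor q p t.
Proof. by rewrite /floor fsetUC fdisjoint_sym. Qed.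

Lemma dart_floor (e : domino_dart D) :
  floor (dart_origin e) (dart_target e) (dart_tiling e).
Proof.
case: e => [p q t pq dpq ht|t ht b] //; split => /=; last exact: fdisjoint0X.
by rewrite fsetU0 fsetD0.
Qed.

Lemma tile_sub p q t e : floor p q t -> e \in t -> e `<=` D `\` (p `|` q).
Proof.
move=> [[_ _ <-] _] et; apply/fsubsetP => x xe.
by apply/bigfcupP; exists e; rewrite ?et.
Qed.

Lemma tileP p q t x : floor p q t -> x \in D -> x \notin p -> x \notin q ->
  exists2 e, e \in t & x \in e.
Proof.
move=> [[_ _ tE] _] xD xp xq.
have : x \in fcover t by rewrite tE !inE negb_or xp xq xD.
by move=> /bigfcupP[e /andP[et _] xe]; exists e.
Qed.

(* [Z] and [Z'] are the two colour classes of a union of components of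
   [D `\` d], possibly exchanged on some of the components; the union contains
   every domino with which [d] can be flipped. *)
Record two_colouring Z Z' : Prop := TwoColouring {
  colouring_sub : Z `|` Z' `<=` D `\` d;
  colouring_disjoint : [disjoint Z & Z'];
  colouring_left : forall x y, x \in Z -> y \in D `\` d ->
    square_adjacent x y -> y \in Z';
  colouring_right : forall x y, x \in Z' -> y \in D `\` d ->
    square_adjacent x y -> y \in Z;
  colouring_block : forall s, block s `<=` D -> d `<=` block s ->
    block s `\` d `<=` Z `|` Z' }.

Lemma two_colouring_sym Z Z' : two_colouring Z Z' -> two_colouring Z' Z.
Proof.
by case=> ? ? ? ? h; split; rewrite // 1?fsetUC 1?fdisjoint_sym // => s ? ?;
  rewrite fsetUC; apply: h.
Qed.

(** A square of the coloured set outside [p] is in [Z'], which bounds the trace of [q]. Conversely,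
    a square of [Z'] outside [q] would be covered by a tile other than [d], whose second square is
    in [Z], hence already in [p]. *)
Lemma floor_colouring Z Z' p q t : two_colouring Z Z' ->
  floor p q t -> d \in t ->
  p `&` (Z `|` Z') = Z -> q `&` (Z `|` Z') = Z'.
Proof.
move=> [sub dis _ right _] F dt pZ.
have inp x : x \in Z `|` Z' -> (x \in p) = (x \in Z).
  by move=> xC; rewrite -pZ inE xC andbT.
apply/fsetP => x; apply/idP/idP => [|xZ'].
  rewrite inE => /andP[xq xC].
  have xp : x \notin p.
    by apply/negP => xp; have := fdisjointP F.2 _ xp; rewrite xq.
  by move: xC (xC); rewrite {1}inE => /orP[xZ|//] /inp; rewrite xZ (negPf xp).
have xC : x \in Z `|` Z' by rewrite inE xZ' orbT.
rewrite inE xC andbT; apply/negPn/negP => xq.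
have xp : x \notin p.
  by rewrite inp //; apply/negP => /(fdisjointP dis); rewrite xZ'.
have := fsubsetP sub _ xC; rewrite inE => /andP[xd xD].
have [e et xe] := tileP F xD xp xq.
have [[dom triv _] _] := F.
have ed : [disjoint e & d].
  by apply: (trivIfsetP _ triv) => //; apply: contraNneq xd => <-.
have [u [v [uv eE]]] := dom _ et.
have [y ye xy] : exists2 y, y \in e & square_adjacent x y.
  move: xe; rewrite eE !inE => /orP[/eqP->|/eqP->].
    by exists v; rewrite ?inE ?eqxx ?orbT.
  by exists u; rewrite ?inE ?eqxx // square_adjacent_sym.
have := fsubsetP (tile_sub F et) _ ye; rewrite !inE => /andP[/norP[yp yq] yD].
have yZ : y \in Z.
  by apply: right xZ' _ xy; rewrite inE yD andbT; exact: (fdisjointP ed).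
by move: yZ; rewrite -pZ inE (negPf yp).
Qed.

Variables Z Z' : {fset square}.
Hypothesis ZZ' : two_colouring Z Z'.
Let C := Z `|` Z'.

Lemma floor_colouringE p q t : floor p q t -> d \in t ->
  ((p `&` C == Z) = (q `&` C == Z')) * ((p `&` C == Z') = (q `&` C == Z)).
Proof.
have ZZ'' := two_colouring_sym ZZ'.
move=> F dt; have F' := floorC F.
split; apply/eqP/eqP; rewrite /C.
- exact: floor_colouring F _.
- by rewrite fsetUC; exact: floor_colouring F' _.
- by rewrite fsetUC; exact: floor_colouring F _.
- exact: floor_colouring F' _.
Qed.

Definition label t p : free_group 'I_2 :=
  if d \in t then
    if p `&` C == Z then gen ord0
    else if p `&` C == Z' then gen ord_max else 1%g
  else 1%g.

Lemma label_notin t p : d \notin t -> label t p = 1%g.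
Proof. by rewrite /label => /negPf ->. Qed.

Lemma label_congr t t' p : (d \in t) = (d \in t') -> label t p = label t' p.
Proof. by rewrite /label => ->. Qed.

(** Since the trace of one plug on [C] can be read off from the other, floors with a common upper
    plug have the same label as soon as they agree on containing [d]. *)
Lemma label_common p p' q t t' : floor p q t -> floor p' q t' ->
  (d \in t) = (d \in t') -> label t p = label t' p'.
Proof.
rewrite /label => F F' dtt'; rewrite -dtt'; case: ifP => // dt.
have dt' : d \in t' by rewrite -dtt'.
by rewrite !(floor_colouringE F dt) !(floor_colouringE F' dt').
Qed.

(** The square [x] is in [C], by [colouring_block], and in neither plug, being covered by [d']. With
    a nontrivial label the traces of the two plugs would be [Z] and [Z'], which cover [C]. *)
Lemma label_flippable p q t s d' x : floor p q t -> d' \in t ->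
  d `|` d' = block s -> x \in d' -> x \notin d -> label t p = 1%g.
Proof.
move=> F d't ds xd' xd; rewrite /label; case: ifP => // dt.
have sD : block s `<=` D.
  rewrite -ds fsubUset; apply/andP; split.
    by apply: fsubset_trans (tile_sub F dt) _; exact: fsubsetDl.
  by apply: fsubset_trans (tile_sub F d't) _; exact: fsubsetDl.
have xC : x \in C.
  apply: (fsubsetP (colouring_block ZZ' sD _)).
    by rewrite -ds fsubsetUl.
  by rewrite inE xd -ds inE xd' orbT.
have := fsubsetP (tile_sub F d't) _ xd'; rewrite !inE => /andP[/norP[xp xq] _].
have absurd : p `&` C = Z /\ q `&` C = Z' \/ p `&` C = Z' /\ q `&` C = Z -> False.
  move=> h; have : (x \in p `&` C) || (x \in q `&` C).
    by case: h => -[-> ->]; move: xC; rewrite inE // orbC.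
  by rewrite !inE (negPf xp) (negPf xq).
have [e1 e2] := floor_colouringE F dt.
case: eqP => [pZ|_].
  by case: absurd; left; split => //; apply/eqP; rewrite -e1 pZ.
case: eqP => // pZ'.
by case: absurd; right; split => //; apply/eqP; rewrite -e2 pZ'.
Qed.

Lemma label_horizontal p q t s : floor p q t -> horizontal_pair s `<=` t ->
  d \in horizontal_pair s -> label t p = 1%g.
Proof.
move=> F /fsubsetP st; rewrite !inE => /orP[] /eqP dE.
  apply: (@label_flippable _ _ _ s _ (s.1, s.2 + 1) F (st _ (fset22 _ _))).
  - by rewrite dE; apply/fsetP => x; rewrite !inE !orbA.
  - by rewrite !inE eqxx.
  - by rewrite dE !inE -!pair_eqE /=; lia.
apply: (@label_flippable _ _ _ s _ s F (st _ (fset21 _ _))).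
- by rewrite dE fsetUC; apply/fsetP => x; rewrite !inE !orbA.
- by rewrite !inE eqxx.
- by rewrite dE !inE -!pair_eqE /=; lia.
Qed.

Lemma label_vertical p q t s : floor p q t -> vertical_pair s `<=` t ->
  d \in vertical_pair s -> label t p = 1%g.
Proof.
move=> F /fsubsetP st; rewrite !inE => /orP[] /eqP dE.
  apply: (@label_flippable _ _ _ s _ (s.1 + 1, s.2) F (st _ (fset22 _ _))).
  - by rewrite dE; apply/fsetP => x; rewrite !inE; do ![case: (x == _) => //=].
  - by rewrite !inE eqxx.
  - by rewrite dE !inE -!pair_eqE /=; lia.
apply: (@label_flippable _ _ _ s _ s F (st _ (fset21 _ _))).
- by rewrite dE; apply/fsetP => x; rewrite !inE; do ![case: (x == _) => //=].
- by rewrite !inE eqxx.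
- by rewrite dE !inE -!pair_eqE /=; lia.
Qed.

(** A flip not involving [d] preserves the membership of [d] in the tiling. A flip that removes or
    creates [d] relates two floors of trivial label. *)
Lemma label_flip p q t t' : floor p q t -> floor p q t' -> flip t t' ->
  label t p = label t' p.
Proof.
suff replace P P' : floor p q t -> floor p q t' ->
    t' = (t `\` P) `|` P' ->
    (d \in P -> label t p = 1%g) -> (d \in P' -> label t' p = 1%g) ->
    label t p = label t' p.
  move=> F F' [s [] [Pt tE]]; apply: (replace _ _ F F' tE).
  - exact: label_horizontal F Pt.
  - by apply: label_vertical F' _; rewrite tE fsubsetUr.
  - exact: label_vertical F Pt.
  - by apply: label_horizontal F' _; rewrite tE fsubsetUr.
move=> F F' tE tP t'P'.
have [dt|dt] := boolP (d \in t); have [dt'|dt'] := boolP (d \in t').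
- by apply: label_common F F' _; rewrite dt dt'.
- rewrite (label_notin _ dt') tP //; apply: contraNT dt' => dP.
  by rewrite tE !inE dP dt.
- rewrite (label_notin _ dt) t'P' //.
  by move: dt'; rewrite tE !inE (negPf dt) andbF.
- by rewrite !label_notin.
Qed.

(** The boolean [b] is the parity of the position, true for odd; the reversed floor has the target
    of [e] as its lower plug. *)
Definition dart_label b (e : domino_dart D) : free_group 'I_2 :=
  if b then ((label (dart_tiling e) (dart_target e))^-1)%g
  else label (dart_tiling e) (dart_origin e).

Fixpoint word_label b (w : seq (domino_dart D)) : free_group 'I_2 :=
  if w is e :: w' then (dart_label b e * word_label (~~ b) w')%g else 1%g.

Lemma word_label_cat b u v :
  word_label b (u ++ v) = (word_label b u * word_label (b (+) odd (size u)) v)%g.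
Proof.
elim: u b => [|e u IH] b /=; first by rewrite addbF mul1g.
by rewrite IH mulgA addbN addNb.
Qed.

Lemma word_label_backtrack b e : word_label b [:: e; dart_opp e] = 1%g.
Proof.
have tE : dart_tiling (dart_opp e) = dart_tiling e by case: e.
case: b; rewrite /= mulg1 /dart_label tE ?dart_origin_opp ?dart_target_opp.
  exact: mulVg.
exact: mulgV.
Qed.

Lemma word_label_face b c : domino_face c -> word_label b c = 1%g.
Proof.
case=> [t ht b'|e e' oE tE _ ff|
  p1 p2 p3 p4 d' e1 e2 e3 e4 dom dis p2E [ og1 tg1] [ og2 tg2] [ og3 tg3] [ og4 tg4] T3 T4].
- by case: b; rewrite /= mulg1 /dart_label /= ?mulVg ?mulgV.
- have tlE : dart_tiling (dart_opp e') = dart_tiling e' by case: (e').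
  have F := dart_floor e; have F' := dart_floor e'.
  rewrite -oE -tE in F'.
  case: b; rewrite /= mulg1 /dart_label tlE ?dart_origin_opp ?dart_target_opp.
    by rewrite -tE (label_flip (floorC F) (floorC F') ff) mulVg.
  by rewrite -oE (label_flip F F' ff) mulgV.
have F1 := dart_floor e1; rewrite og1 tg1 in F1.
have F2 := dart_floor e2; rewrite og2 tg2 in F2.
have F3 := dart_floor e3; rewrite og3 tg3 in F3.
have F4 := dart_floor e4; rewrite og4 tg4 in F4.
(* When the slid domino is [d], it lies in the plug [p2], so [e1] and [e2] do not use it; [e3] and
   [e4] both do and share the plug [p3], so their labels cancel. *)
have [d'd|d'd] := eqVneq d' d.
  have out p t : floor p p2 t -> d \notin t.
    move=> F; apply/negP => /(tile_sub F)/fsubsetP dD.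
    have [u [v [_ dE]]] := dom.
    have ud : u \in d by rewrite -d'd dE !inE eqxx.
    by have := dD u ud; rewrite !inE p2E !inE d'd ud !orbT.
  have n1 := out _ _ F1; have n2 := out _ _ (floorC F2).
  have d3 : d \in dart_tiling e3 by rewrite T3 d'd !inE eqxx.
  have d4 : d \in dart_tiling e4 by rewrite T4 d'd !inE eqxx.
  have d34 : (d \in dart_tiling e3) = (d \in dart_tiling e4) by rewrite d3 d4.
  case: b; rewrite /= mulg1 /dart_label ?og1 ?tg1 ?og2 ?tg2 ?og3 ?tg3 ?og4 ?tg4;
    rewrite (label_notin _ n1) (label_notin _ n2) ?invg1 !mul1g.
    by rewrite (label_congr p3 d34) mulVg.
  by rewrite (label_common F3 (floorC F4) d34) mulgV.
(* Otherwise [e1] and [e4] agree on [d] and share [p1], while [e2] and [e3] agree on [d] and share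
   [p4]; the labels cancel in these pairs. *)
have d3 : (d \in dart_tiling e2) = (d \in dart_tiling e3).
  by rewrite T3 !inE eq_sym (negPf d'd).
have d4 : (d \in dart_tiling e1) = (d \in dart_tiling e4).
  by rewrite T4 !inE eq_sym (negPf d'd).
case: b; rewrite /= mulg1 /dart_label ?og1 ?tg1 ?og2 ?tg2 ?og3 ?tg3 ?og4 ?tg4.
  rewrite (label_common F2 (floorC F3) d3) (label_common (floorC F1) F4 d4).
  by rewrite mulVKg mulVg.
rewrite (label_congr p1 d4) (label_congr p4 d3).
by rewrite mulKg mulgV.
Qed.

Notation loop := (edge_loop (empty_plug D : vertex (domino_complex D))).

Lemma word_label_homotopic (a a' : loop) : homotopic a a' ->
  word_label false a = word_label false a'.
Proof.
elim=> [{}a {}a' aa'|//|{}a {}a' _ ->//|{}a c {}a' _ -> _ ->//].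
case: aa' => [u e v|u c v cf]; rewrite !word_label_cat.
  by rewrite word_label_backtrack mul1g; case: (odd (size u)).
(* Every face has even length, so deleting it preserves the parity of the later positions. *)
rewrite (word_label_face _ cf) mul1g; congr (_ * word_label _ v)%g.
by case: cf => *; case: (odd (size u)).
Qed.

Definition even_label (g : even_domino_group D) : free_group 'I_2 :=
  word_label false (loop_word (repr (even_val g))).

Lemma even_label_pi (a : loop)
    (ha : \pi_(domino_group D) a \in @even_elements D) :
  even_label (EvenElement ha) = word_label false a.
Proof. exact/word_label_homotopic/repr_pi. Qed.

Lemma even_label_morphism : {morph even_label : g h / (g * h)%g >-> (g * h)%g}.
Proof.
move=> g h; rewrite /even_label.
have -> : even_val (g * h)%g = \pi_(domino_group D)
    (loop_mul (repr (even_val g)) (repr (even_val h))) by [].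
rewrite (word_label_homotopic (repr_pi _)) /= word_label_cat.
congr (_ * word_label _ _)%g.
(* Evenness of [g] makes the word of [h] start in an even position; this is where the restriction to
   the even group enters. *)
have := even_valP g; rewrite inE => /eqP.
rewrite /length_mod2 natZ2_odd; case: odd => //.
Qed.

HB.instance Definition _ := monoid.isMultiplicative.Build
  (even_domino_group D) (free_group 'I_2) even_label even_label_morphism.

Definition even_label_hom :
  {multiplicative even_domino_group D -> free_group 'I_2} := even_label.

End Label.

(** * Walks with trivial label *)

Lemma white_adjacent s s' : square_adjacent s s' -> white s' = ~~ white s.
Proof.
case: s s' => [a b] [a' b']; rewrite /square_adjacent /white /=.
move=> h; have [e|e] : a' + b' = a + b + 1 \/ a' + b' = a + b - 1 by lia.
all: by rewrite e; apply/idP/negP; lia.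
Qed.

(** * Counting white and black squares *)

Section Balance.
Implicit Types (X Y : {fset square}) (b : bool).

Definition colour_class c X := [fset s in X | white s == c].

Definition colour_count c X := #|` colour_class c X|.

Lemma balancedE X : balanced X = (colour_count true X == colour_count false X).
Proof.
have cE c : colour_count c X = #|` [fset s in X | if c then white s else ~~ white s]|.
  by congr #|` _|; apply/fsetP => s; rewrite !inE; case: c; rewrite ?eqb_id ?eqbF_neg.
by rewrite !cE.
Qed.

Lemma colour_countU c X Y : [disjoint X & Y] -> colour_count c (X `|` Y) = (colour_count c X + colour_count c Y)%N.
Proof.
move=> XY; rewrite /colour_count /colour_class -cardfsUI.
rewrite (_ : _ `&` _ = fset0) ?cardfs0 ?addn0.
  by congr #|` _|; apply/fsetP => s; rewrite !inE andb_orl.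
apply/fsetP => s; rewrite !inE; apply/negP => /andP[/andP[/(fdisjointP XY)]].
by move=> /negP h _ /andP[].
Qed.

Lemma colour_count_card X : (colour_count true X + colour_count false X)%N = #|` X|.
Proof.
rewrite /colour_count /colour_class -cardfsUI (_ : _ `&` _ = fset0) ?cardfs0 ?addn0.
  by congr #|` _|; apply/fsetP => s; rewrite !inE; case: white; rewrite ?andbT ?andbF ?orbF.
by apply/fsetP => s; rewrite !inE; case: white; rewrite ?andbT ?andbF.
Qed.

Lemma colour_count1 c s : colour_count c [fset s] = (white s == c).
Proof.
rewrite /colour_count /colour_class; case: eqP => h.
  rewrite (_ : [fset _ in _ | _] = [fset s]) ?cardfs1 //.
  by apply/fsetP => x; rewrite !inE; case: eqVneq => // ->; apply/eqP.
rewrite (_ : [fset _ in _ | _] = fset0) ?cardfs0 //.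
by apply/fsetP => x; rewrite !inE; case: eqVneq => // ->; apply/eqP.
Qed.

Lemma colour_count_domino c e : is_domino e -> colour_count c e = 1%N.
Proof.
move=> [s [s' [ss' ->]]]; rewrite colour_countU ?colour_count1 ?(white_adjacent ss').
  by case: c; case: (white s).
rewrite fdisjoint1X inE; apply/eqP => sE.
by move: (white_adjacent ss'); rewrite sE; case: white.
Qed.

Lemma colour_countD c X Y : Y `<=` X -> colour_count c (X `\` Y) = (colour_count c X - colour_count c Y)%N.
Proof.
move=> YX; rewrite -[in RHS](fsetID Y X) (fsetIidPr YX) colour_countU ?addKn //.
by apply/fdisjointP => s sY; rewrite inE sY.
Qed.

Lemma colour_count_gt0 c X : (0 < colour_count c X)%N -> exists2 s, s \in X & white s = c.
Proof.
by rewrite cardfs_gt0 => /fset0Pn[s]; rewrite !inE => /andP[sX /eqP]; exists s.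
Qed.

Lemma colour_classK b b' c : colour_class b (colour_class b' c) =
  if b == b' then colour_class b c else fset0.
Proof.
apply/fsetP => x; case: b b' => -[]; rewrite /= !inE;
  by case: white; rewrite ?andbT ?andbF.
Qed.

Lemma colour_classU c : colour_class true c `|` colour_class false c = c.
Proof. by apply/fsetP => x; rewrite !inE; case: white; rewrite ?andbT ?andbF ?orbF. Qed.

Lemma colour_classes_cover c1 c2 :
  (colour_class true c1 `|` colour_class false c2) `|`
  (colour_class false c1 `|` colour_class true c2) = c1 `|` c2.
Proof.
by rewrite fsetUACA colour_classU [X in _ `|` X]fsetUC colour_classU.
Qed.

End Balance.

(** The eight ordered placements of a domino in a block are treated one by one; the other two
    squares form the parallel domino. *)
Lemma block_domino d s : is_domino d -> d `<=` block s ->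
  exists x y x' y', [/\ d = [fset x; y], block s `\` d = [fset x'; y'],
    square_adjacent x x' /\ square_adjacent y y' & square_adjacent x' y'].
Proof.
move=> [u [v [uv ->]]]; rewrite fsubUset !fsub1set.
case: s => a b; rewrite !inE -!orbA /=.
by move=> /andP[/or4P[] /eqP ? /or4P[] /eqP ?]; subst u v;
  move: uv; rewrite /square_adjacent /= => uv; try lia;
 [exists (a, b), (a + 1, b), (a, b + 1), (a + 1, b + 1)
 |exists (a, b), (a, b + 1), (a + 1, b), (a + 1, b + 1)
 |exists (a + 1, b), (a, b), (a + 1, b + 1), (a, b + 1)
 |exists (a + 1, b), (a + 1, b + 1), (a, b), (a, b + 1)
 |exists (a, b + 1), (a, b), (a + 1, b + 1), (a + 1, b)
 |exists (a, b + 1), (a + 1, b + 1), (a, b), (a + 1, b)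
 |exists (a + 1, b + 1), (a + 1, b), (a, b + 1), (a, b)
 |exists (a + 1, b + 1), (a, b + 1), (a + 1, b), (a, b)];
 (split; [by []|apply/eqP; rewrite eqEfsubset fsubDset !fsubUset !fsub1set !inE -!pair_eqE /=; lia
         |rewrite /=; lia|rewrite /=; lia]).
Qed.

(** * Even walks between plugs and their labels *)

Section Moves.
Variables D d Z Z' : {fset square}.
Implicit Types (X Y e : {fset square}) (t : {fset {fset square}}) (b : bool).

Notation walk := (walk_along (@dart_origin D) (@dart_target D)).
Notation wl := (word_label d Z Z').
Notation F2 := (free_group 'I_2).

Definition is_plug X : bool := (X `<=` D) && balanced X.

(** The ends are sets of squares, which keeps proofs of being a plug out of the statements; even
    length makes labels multiply under concatenation. *)
Definition joined (g : F2) X Y : Prop := exists (p q : plug D) w,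
  [/\ p = X :> {fset square}, q = Y :> {fset square}, walk p w q,
      ~~ odd (size w) & wl false w = g].

Lemma word_label_inv b w :
  (wl b w * wl (b (+) odd (size w)) (@inv_word (domino_complex D) w))%g = 1%g.
Proof.
elim: w b => [|e w IH] b; first exact: mulg1.
rewrite /inv_word /= rev_cons -cats1 word_label_cat /= size_rev size_map.
have -> : b (+) ~~ odd (size w) = ~~ b (+) odd (size w) by case: b; case: odd.
rewrite addbK -mulgA (mulgA (wl _ w)) IH mul1g.
exact: (word_label_backtrack d Z Z' b e).
Qed.

Lemma joined_trans g h X Y U : joined g X Y -> joined h Y U ->
  joined (g * h)%g X U.
Proof.
move=> [p [q [v [pX qY pq ov <-]]]] [q' [r [w [qY' rU qr ow <-]]]].
have qq' : q' = q by apply: val_inj; rewrite /= qY.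
exists p, r, (v ++ w); split => //.
- by apply: (@walk_cat (domino_complex D)) pq _; rewrite -qq'.
- by rewrite size_cat oddD (negPf ov).
- by rewrite word_label_cat /= (negPf ov).
Qed.

Lemma joined_sym g X Y : joined g X Y -> joined g^-1%g Y X.
Proof.
move=> [p [q [w [pX qY pq ow <-]]]].
exists q, p, (@inv_word (domino_complex D) w); split => //.
- exact: (@walk_inv (domino_complex D)) pq.
- by rewrite /inv_word size_rev size_map.
- apply: (mulgI (wl false w)); rewrite mulgV.
  by have := word_label_inv false w; rewrite (negPf ow).
Qed.

Definition freely_joined := joined 1%g.

Lemma freely_refl X : is_plug X -> freely_joined X X.
Proof. by move=> pX; exists (Plug pX), (Plug pX), [::]. Qed.

Lemma freely_trans Y X U : freely_joined X Y -> freely_joined Y U ->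
  freely_joined X U.
Proof. by move=> XY /(joined_trans XY); rewrite mulg1. Qed.

Lemma freely_sym X Y : freely_joined X Y -> freely_joined Y X.
Proof. by move=> /joined_sym; rewrite invg1. Qed.

Lemma freely_plug X Y : freely_joined X Y -> is_plug Y.
Proof. by move=> [p [q [w [_ <- _ _ _]]]]; exact: (plugP q). Qed.

Lemma balancedU X Y : [disjoint X & Y] -> balanced Y ->
  balanced (X `|` Y) = balanced X.
Proof.
by move=> XY; rewrite !balancedE !colour_countU // => /eqP ->; rewrite eqn_add2r.
Qed.

Lemma balanced_domino e : is_domino e -> balanced e.
Proof. by move=> de; rewrite balancedE !colour_count_domino. Qed.

Lemma balancedD X Y : Y `<=` X -> balanced X -> balanced Y -> balanced (X `\` Y).
Proof. by move=> YX; rewrite !balancedE !colour_countD // => /eqP -> /eqP ->. Qed.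

Hypothesis balD : balanced D.

(* The walk goes through the complement of [X `|` e]; its floors are tiled by
   [e] alone and by nothing. *)
Lemma joined_domino X e : is_plug X -> is_domino e -> e `<=` D -> e != D ->
  [disjoint X & e] -> joined (label d Z Z' [fset e] X) X (X `|` e).
Proof.
move=> pX de eD neD Xe.
have /andP[XD bX] := pX.
have pXe : is_plug (X `|` e).
  by rewrite /is_plug fsubUset XD eD balancedU // balanced_domino.
have /andP[XeD bXe] := pXe.
have pY : is_plug (D `\` (X `|` e)).
  by rewrite /is_plug fsubsetDl balancedD.
have [u ue] : exists u, u \in e.
  by have [u [v [_ ->]]] := de; exists u; rewrite !inE eqxx.
pose x := Plug pX; pose y := Plug pY; pose z := Plug pXe.
(* If [X] were equal to the complement of its union with [e], every square of [D] would be in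
   [e]. *)
have xy : x != y.
  apply: contra neD => /eqP /(congr1 (fun p : plug D => p : {fset square})) /= XE.
  rewrite eqEfsubset eD; apply/fsubsetP => s sD.
  have := erefl (s \in X); rewrite {1}XE !inE sD andbT negb_or.
  by case: (s \in X); case: (s \in e).
have yz : y != z.
  apply/eqP => /(congr1 (fun p : plug D => u \in (p : {fset square}))) /=.
  by rewrite !inE ue !orbT.
have dxy : [disjoint x & y].
  by apply/fdisjointP => s /= sX; rewrite !inE sX.
have dyz : [disjoint y & z].
  by apply/fdisjointP => s /=; rewrite !inE => /andP[].
have txy : tiling (D `\` (x `|` y)) [fset e].
  split.
  - by move=> e'; rewrite inE => /eqP ->.
  - by apply/trivIfsetP => A B; rewrite !inE => /eqP -> /eqP ->; rewrite eqxx.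
  - rewrite /fcover big_seq_fset1; apply/fsetP => s; rewrite !inE /=.
    have [se|se] := boolP (s \in e); rewrite /= ?orbF ?orbT.
      have sX : s \notin X by apply/negP => /(fdisjointP Xe); rewrite se.
      by rewrite (fsubsetP eD _ se) (negPf sX).
    by case: (s \in X); case: (s \in D).
have tyz : tiling (D `\` (y `|` z)) fset0.
  split => //.
  - by apply/trivIfsetP => A B; rewrite inE.
  - rewrite /fcover big_seq_fset0; apply/fsetP => s; rewrite !inE /=.
    by case: (s \in X); case: (s \in e); case: (s \in D).
exists x, z, [:: PlugDart xy dxy txy; PlugDart yz dyz tyz]; split => //=.
rewrite /dart_label /= (@label_notin d Z Z' fset0) ?inE // invg1 !mulg1 //.
Qed.

Hypothesis dom_d : is_domino d.
Variable s0 : square.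
Hypothesis s0D : block s0 `<=` D.
Hypothesis ds0 : d `<=` block s0.

Lemma card_domino e : is_domino e -> #|` e| = 2%N.
Proof. by move=> de; rewrite -colour_count_card !colour_count_domino. Qed.

Lemma domino_neq e : is_domino e -> e != D.
Proof.
move=> de; have [x [y [x' [y' [_ sub _ _]]]]] := block_domino dom_d ds0.
apply/eqP => eD; have dD : d `<=` D by exact: fsubset_trans ds0 s0D.
have dDE : d == D by rewrite eqEfcard dD -eD !card_domino.
have : x' \in block s0 `\` d by rewrite sub !inE eqxx.
rewrite inE => /andP[/negP xd xs].
by apply: xd; rewrite (eqP dDE) (fsubsetP s0D).
Qed.

Lemma freely_add_neq X e : is_plug X -> is_domino e -> e `<=` D -> e != d ->
  [disjoint X & e] -> freely_joined X (X `|` e).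
Proof.
move=> pX de eD ed Xe; have := joined_domino pX de eD (domino_neq de) Xe.
by rewrite label_notin // inE eq_sym.
Qed.

Lemma freely_remove_of X e : is_plug X -> is_domino e -> e `<=` X ->
  (is_plug (X `\` e) -> [disjoint X `\` e & e] ->
     freely_joined (X `\` e) ((X `\` e) `|` e)) ->
  freely_joined X (X `\` e).
Proof.
move=> /andP[XD bX] de eX add; apply: freely_sym.
have XE : (X `\` e) `|` e = X.
  by rewrite fsetUC -{1}(fsetIidPr eX) fsetID.
rewrite -{2}XE; apply: add; last by apply/fdisjointP => s; rewrite inE => /andP[].
by rewrite /is_plug (fsubset_trans (fsubsetDl _ _) XD) balancedD // balanced_domino.
Qed.

Lemma freely_remove_neq X e : is_plug X -> is_domino e -> e `<=` X -> e != d ->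
  freely_joined X (X `\` e).
Proof.
move=> pX de eX ed; apply: freely_remove_of => // pXe dis.
apply: freely_add_neq => //; apply: fsubset_trans eX _.
by case/andP: pX.
Qed.

Lemma domino2 s s' : square_adjacent s s' -> is_domino [fset s; s'].
Proof. by exists s, s'. Qed.

(* In a block made of [d] and [e], the domino [d] can be added to a plug without
   ever using a floor containing [d]: the vertical dominoes of the block are
   used instead. *)
Lemma freely_add_d X : is_plug X -> [disjoint X & d] ->
  freely_joined X (X `|` d).
Proof.
have [x [y [x' [y' [dE sub [xx' yy'] xy']]]]] := block_domino dom_d ds0.
move=> pX; rewrite dE => Xd.
have x'P : (x' \in block s0) && (x' \notin d).
  by rewrite andbC -in_fsetD sub !inE eqxx.
have y'P : (y' \in block s0) && (y' \notin d).
  by rewrite andbC -in_fsetD sub !inE eqxx orbT.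
have [/(fsubsetP s0D) x'D] := andP x'P; rewrite dE !inE => /norP[x'x x'y].
have [/(fsubsetP s0D) y'D] := andP y'P; rewrite dE !inE => /norP[y'x y'y].
have xD : x \in D by apply/(fsubsetP s0D)/(fsubsetP ds0); rewrite dE !inE eqxx.
have yD : y \in D by apply/(fsubsetP s0D)/(fsubsetP ds0); rewrite dE !inE eqxx orbT.
have xy : x != y.
  apply/eqP => xyE; have := card_domino dom_d.
  by rewrite dE xyE fsetUid cardfs1.
have x'y' : x' != y'.
  apply/eqP => xyE; have := white_adjacent xy'.
  by rewrite xyE; case: white.
have xX : x \notin X.
  by apply/negP => /(fdisjointP Xd); rewrite !inE eqxx.
have yX : y \notin X.
  by apply/negP => /(fdisjointP Xd); rewrite !inE eqxx orbT.
have nd u v : u \notin d -> [fset u; v] != d.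
  by apply: contraNneq => <-; rewrite !inE eqxx.
have dx : is_domino [fset x'; x] by apply: domino2; rewrite square_adjacent_sym.
have dy : is_domino [fset y'; y] by apply: domino2; rewrite square_adjacent_sym.
have dxy := domino2 xy'.
have nx := nd x' x (andP x'P).2; have ny := nd y' y (andP y'P).2.
have nxy := nd x' y' (andP x'P).2.
have sDx : [fset x'; x] `<=` D by rewrite fsubUset !fsub1set x'D.
have sDy : [fset y'; y] `<=` D by rewrite fsubUset !fsub1set y'D.
have sDxy : [fset x'; y'] `<=` D by rewrite fsubUset !fsub1set x'D.
have neqs := (negPf x'x, negPf x'y, negPf y'x, negPf y'y, negPf xy, negPf x'y').
have neqs' : ((x == x') = false) * ((y == x') = false) * ((x == y') = false) *
    ((y == y') = false) * ((y == x) = false) * ((y' == x') = false).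
  by do !split; rewrite eq_sym neqs.
have disj2 U u v : u \notin U -> v \notin U -> [disjoint U & [fset u; v]].
  by move=> uU vU; rewrite fdisjointXU !fdisjointX1 uU.
have add U u v W : freely_joined X U -> is_domino [fset u; v] ->
    [fset u; v] `<=` D -> [fset u; v] != d -> u \notin U -> v \notin U ->
    W = U `|` [fset u; v] -> freely_joined X W.
  move=> XU du uD nu uU vU ->; apply: (freely_trans XU).
  by apply: freely_add_neq => //; [exact: freely_plug XU|exact: disj2].
have rem U u v W : freely_joined X U -> is_domino [fset u; v] ->
    [fset u; v] != d -> u \in U -> v \in U ->
    W = U `\` [fset u; v] -> freely_joined X W.
  move=> XU du nu uU vU ->; apply: (freely_trans XU).
  apply: freely_remove_neq => //; first exact: freely_plug XU.
  by rewrite fsubUset !fsub1set uU.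
have step0 := freely_refl pX.
(* In all four cases the dominoes on [x', x] and [y', y] are added and the one on [x', y'] is
   removed; the order is chosen so that added squares are free and removed ones occupied. *)
have [x'X|x'X] := boolP (x' \in X); have [y'X|y'X] := boolP (y' \in X).
- have step1 := rem _ x' y' _ step0 dxy nxy x'X y'X erefl.
  have step2 := add _ x' x _ step1 dx sDx nx _ _ erefl.
  have step3 := add _ y' y _ (step2 _ _) dy sDy ny _ _ erefl.
  rewrite (_ : X `|` _ = X `\` [fset x'; y'] `|` [fset x'; x] `|` [fset y'; y]).
    by apply: step3; rewrite ?inE ?eqxx ?neqs ?neqs' ?(negPf xX) ?(negPf yX) ?orbT ?andbF.
  apply/fsetP => z; rewrite !inE.
  have [->|_] := eqVneq z x'; first by rewrite x'X orbT.
  have [->|_] := eqVneq z y'; first by rewrite y'X !orbT.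
  by rewrite /= -orbA.
- have step1 := add _ y' y _ step0 dy sDy ny y'X yX erefl.
  have step2 := rem _ x' y' _ step1 dxy nxy _ _ erefl.
  have step3 := add _ x' x _ (step2 _ _) dx sDx nx _ _ erefl.
  rewrite (_ : X `|` _ = (X `|` [fset y'; y]) `\` [fset x'; y'] `|` [fset x'; x]).
    by apply: step3; rewrite ?inE ?eqxx ?neqs ?neqs' ?x'X ?(negPf xX) ?(negPf yX) ?orbT ?andbF.
  apply/fsetP => z; rewrite !inE.
  have [->|_] := eqVneq z x'; first by rewrite x'X !orbT.
  have [->|_] := eqVneq z y'; first by rewrite (negPf y'X) ?neqs ?neqs'.
  by rewrite /= orbAC -orbA.
- have step1 := add _ x' x _ step0 dx sDx nx x'X xX erefl.
  have step2 := rem _ x' y' _ step1 dxy nxy _ _ erefl.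
  have step3 := add _ y' y _ (step2 _ _) dy sDy ny _ _ erefl.
  rewrite (_ : X `|` _ = (X `|` [fset x'; x]) `\` [fset x'; y'] `|` [fset y'; y]).
    by apply: step3; rewrite ?inE ?eqxx ?neqs ?neqs' ?y'X ?(negPf xX) ?(negPf yX) ?orbT ?andbF.
  apply/fsetP => z; rewrite !inE.
  have [->|_] := eqVneq z x'; first by rewrite (negPf x'X) ?neqs ?neqs'.
  have [->|_] := eqVneq z y'; first by rewrite y'X !orbT.
  by rewrite /= -orbA.
- have step1 := add _ x' x _ step0 dx sDx nx x'X xX erefl.
  have step2 := add _ y' y _ step1 dy sDy ny _ _ erefl.
  have step3 := rem _ x' y' _ (step2 _ _) dxy nxy _ _ erefl.
  rewrite (_ : X `|` _ = (X `|` [fset x'; x] `|` [fset y'; y]) `\` [fset x'; y']).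
    by apply: step3; rewrite ?inE ?eqxx ?neqs ?neqs' ?(negPf x'X) ?(negPf y'X) ?(negPf xX) ?(negPf yX) ?orbT ?andbF.
  apply/fsetP => z; rewrite !inE.
  have [->|_] := eqVneq z x'; first by rewrite (negPf x'X) ?neqs ?neqs'.
  have [->|_] := eqVneq z y'; first by rewrite (negPf y'X) ?neqs ?neqs'.
  by rewrite /= -orbA.
Qed.

Lemma freely_add X e : is_plug X -> is_domino e -> e `<=` D ->
  [disjoint X & e] -> freely_joined X (X `|` e).
Proof.
move=> pX de eD; have [->|ed] := eqVneq e d; first exact: freely_add_d.
exact: freely_add_neq.
Qed.

Lemma freely_remove X e : is_plug X -> is_domino e -> e `<=` X ->
  freely_joined X (X `\` e).
Proof.
move=> pX de eX; apply: freely_remove_of => // pXe dis.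
by apply: freely_add => //; apply: fsubset_trans eX _; case/andP: pX.
Qed.

Hypothesis linkedD : forall s s' : D, linked s s'.

(** A square of a plug can be transported along a path to a free square of its own colour, or
    cancelled against an occupied square of the other colour. Both claims are proved together, by
    induction on the path: its last edge is a domino that is added or removed before or after the
    move given by induction, depending on whether [u] is occupied. *)
Lemma freely_path (s s' : D) X : is_plug X -> val s \in X ->
  (white (val s) = white (val s') -> val s' \notin X ->
     freely_joined X (val s' |` (X `\ val s))) /\
  (white (val s) != white (val s') -> val s' \in X ->
     freely_joined X (X `\` [fset val s; val s'])).
Proof.
have /connectP[w sw ->] := linkedD s s'.
elim/last_ind: w sw X => [_ X pX sX|w v IH].
  by rewrite sX eqxx; split.
rewrite rcons_path last_rcons => /andP[/IH {}IH]; move: IH.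
set u := last s w; rewrite -/(val u).
move: (val s) (val u) (val v) (valP u) (valP v) => {w s s' u v} s u v.
move=> uD vD IH uv X pX sX.
have wv := white_adjacent uv; have duv := domino2 uv.
have uvD : [fset u; v] `<=` D by rewrite fsubUset !fsub1set uD.
have neuv : u != v by apply/eqP => uvE; move: wv; rewrite uvE; case: white.
have [_ bX] := andP pX.
split=> [wsv vX|wsv vX].
  have wsu : white s != white u by rewrite wsv wv; case: (white u).
  have sv : s != v by apply: contraNneq vX => <-.
  have su : s != u by apply: contraNneq wsu => ->.
  have neqs := (eq_sym u s, eq_sym v s, eq_sym v u, negPf sv, negPf su, negPf neuv).
  have [uX|uX] := boolP (u \in X).
    have step := (IH _ pX sX).2 wsu uX.
    apply: (freely_trans step).
    rewrite (_ : v |` _ = X `\` [fset s; u] `|` [fset u; v]).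
      apply: freely_add => //; first exact: freely_plug step.
      by rewrite fdisjointXU !fdisjointX1 !inE eqxx orbT (negPf vX) andbF.
    apply/fsetP => x; rewrite !inE.
    have [->|_] := eqVneq x u; first by rewrite !neqs uX orbT.
    by rewrite /= orbF orbC.
  have step : freely_joined X (X `|` [fset u; v]).
    by apply: freely_add => //; rewrite fdisjointXU !fdisjointX1 uX.
  apply: (freely_trans step).
  rewrite (_ : v |` _ = (X `|` [fset u; v]) `\` [fset s; u]).
    by apply: (IH _ (freely_plug step) _).2; rewrite // !inE ?sX // eqxx orbT.
  apply/fsetP => x; rewrite !inE.
  have [->|xv] := eqVneq x v; first by rewrite !neqs !orbT.
  have [->|_] := eqVneq x u; first by rewrite (negPf uX) orbT andbF.
  by rewrite /= !orbF.
have wsu : white s = white u by move: wsv; rewrite wv; do 2!case: white.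
have sv : s != v by apply: contraNneq wsv => ->.
have [suE|su] := eqVneq s u.
  by rewrite suE; apply: freely_remove => //; rewrite fsubUset !fsub1set -suE sX.
have neqs := (eq_sym u s, eq_sym v s, eq_sym v u, negPf sv, negPf su, negPf neuv).
have [uX|uX] := boolP (u \in X).
  have step : freely_joined X (X `\` [fset u; v]).
    by apply: freely_remove => //; rewrite fsubUset !fsub1set uX.
  apply: (freely_trans step).
  rewrite (_ : _ `\` [fset s; v] = u |` ((X `\` [fset u; v]) `\ s)).
    by apply: (IH _ (freely_plug step) _).1; rewrite // !inE ?eqxx // !neqs.
  apply/fsetP => x; rewrite !inE.
  have [->|_] := eqVneq x u; first by rewrite !neqs uX.
  by rewrite /= negb_or andbA.
have step := (IH _ pX sX).1 wsu uX.
apply: (freely_trans step).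
rewrite (_ : X `\` [fset s; v] = (u |` (X `\ s)) `\` [fset u; v]).
  apply: freely_remove => //; first exact: freely_plug step.
  by rewrite fsubUset !fsub1set !inE !neqs eqxx vX orbT.
apply/fsetP => x; rewrite !inE.
have [->|_] := eqVneq x u; first by rewrite (negPf uX) andbF.
by rewrite /= negb_or andbA [_ && (x != s)]andbC.
Qed.

(** A nonempty balanced plug has a square of each colour, and [freely_path] cancels such a pair. *)
Lemma freely_empty X : is_plug X -> freely_joined X fset0.
Proof.
have [n] := ubnP #|` X|; elim: n X => // n IH X Xn pX.
have [X0|X0] := eqVneq X fset0; first by rewrite -X0; exact: freely_refl.
have [XD] := andP pX; rewrite balancedE => /eqP bX.
have : (0 < #|` X|)%N by rewrite cardfs_gt0.
rewrite -colour_count_card bX addnn double_gt0 => cf.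
have ct : (0 < colour_count true X)%N by rewrite bX.
have [s sX ws] := colour_count_gt0 ct; have [s' sX' ws'] := colour_count_gt0 cf.
have step := (@freely_path [` fsubsetP XD _ sX] [` fsubsetP XD _ sX'] X pX sX).2.
rewrite /= ws ws' in step; have {}step := step isT sX'.
apply: (freely_trans step); apply: IH (freely_plug step).
rewrite ltnS in Xn; apply: leq_trans Xn.
apply: fproper_ltn_card; rewrite fproperEneq fsubsetDl andbT.
by apply: contraTneq sX => <-; rewrite !inE eqxx.
Qed.

Hypothesis ZZ' : two_colouring D d Z Z'.

(** The closed walk goes freely from the empty plug to [X], adds [d] directly through a floor tiled
    by [d], and returns freely; only the middle part contributes to the label. *)
Lemma even_label_d X : is_plug X -> [disjoint X & d] ->
  exists g : even_domino_group D, even_label d Z Z' g = label d Z Z' [fset d] X.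
Proof.
move=> pX Xd; have dD : d `<=` D by exact: fsubset_trans ds0 s0D.
have there := freely_sym (freely_empty pX).
have mid := joined_domino pX dom_d dD (domino_neq dom_d) Xd.
have back := freely_empty (freely_plug (freely_add_d pX Xd)).
have := joined_trans (joined_trans there mid) back; rewrite mul1g mulg1.
move=> [p [q [w [p0 q0 pq ow <-]]]].
have pE : p = empty_plug D by exact: val_inj.
have qE : q = empty_plug D by exact: val_inj.
rewrite pE qE in pq.
pose a := @EdgeLoop (domino_complex D) (empty_plug D) w pq.
have ha : \pi_(domino_group D) a \in @even_elements D.
  by rewrite inE length_mod2E /= natZ2_odd (negPf ow).
by exists (EvenElement ha); rewrite (even_label_pi ZZ').
Qed.

End Moves.

(** * Colourings and balanced plugs *)

Lemma mem_block s u : u \in block s ->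
  (0 <= u.1 - s.1 <= 1) && (0 <= u.2 - s.2 <= 1).
Proof.
by case: s u => a b [a' b']; rewrite !inE -!pair_eqE /=; lia.
Qed.

(** A domino lies in exactly two blocks, one on each of its long sides. *)
Lemma domino_blocks d s s' s'' : is_domino d ->
  d `<=` block s -> d `<=` block s' -> d `<=` block s'' ->
  [|| s == s', s'' == s | s'' == s'].
Proof.
move=> [u [v [uv ->]]]; rewrite !fsubUset !fsub1set.
move=> /andP[/mem_block us /mem_block vs] /andP[/mem_block us' /mem_block vs'].
move=> /andP[/mem_block us'' /mem_block vs''].
move: s s' s'' u v uv us vs us' vs' us'' vs''.
move=> [a b] [a' b'] [a'' b''] [x y] [x' y']; rewrite /square_adjacent -!pair_eqE /=.
lia.
Qed.

(** * Connected components of a set of squares *)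

Section Components.
Variable E : {fset square}.
Implicit Types (c : {fset square}) (u v : E).

Definition adjacent_closed c := forall x y,
  x \in c -> y \in E -> square_adjacent x y -> y \in c.

Definition component_of u : {fset square} := [fset val v | v in linked u].

Lemma component_ofP u : component E (component_of u).
Proof. by exists u. Qed.

Lemma mem_component_of u v : (val v \in component_of u) = linked u v.
Proof.
apply/imfsetP/idP => [[w /= uw /val_inj -> //] | uv]; by exists v.
Qed.

Lemma component_of_sub u : component_of u `<=` E.
Proof. by apply/fsubsetP => _ /imfsetP[v _ ->]; exact: valP. Qed.

Lemma component_of_closed u : adjacent_closed (component_of u).
Proof.
move=> _ y /imfsetP[v /= uv ->] yE vy.
have := mem_component_of u [` yE]; rewrite /= => ->.
by apply: connect_trans uv _; exact: connect1.
Qed.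

Lemma linked_sym : symmetric (@linked E).
Proof. by apply: sym_connect_sym => u v; exact: square_adjacent_sym. Qed.

Lemma component_of_disjoint u v : val v \notin component_of u ->
  [disjoint component_of u & component_of v].
Proof.
rewrite mem_component_of => uv; apply/fdisjointP => _ /imfsetP[w /= uw ->].
apply: contra uv; rewrite mem_component_of linked_sym => wv.
exact: connect_trans uw wv.
Qed.

End Components.

(** * The components meeting a block that contains the domino *)

Section FlippableComponents.
Variables D d : {fset square}.
Hypothesis dom_d : is_domino d.
Let E := D `\` d.

Lemma block_closed c s x : adjacent_closed E c -> block s `<=` D ->
  d `<=` block s -> x \in block s `\` d -> x \in c -> block s `\` d `<=` c.
Proof.
move=> cc sD ds; have [_ [_ [x' [y' [_ sE _ xy]]]]] := block_domino dom_d ds.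
have sub z : z \in [fset x'; y'] -> z \in E.
  by rewrite -sE !in_fsetD => /andP[-> /(fsubsetP sD)].
have x'E := sub _ (fset21 _ _); have y'E := sub _ (fset22 _ _).
rewrite sE fsubUset !fsub1set => /fset2P[->|->] xc.
  by rewrite xc (cc _ _ xc y'E).
by rewrite xc andbT (cc _ _ xc x'E) // square_adjacent_sym.
Qed.

Lemma flippable_components (small : {fset square} -> Prop) :
  (forall c, component E c ->
     (exists s, [/\ block s `<=` D, d `<=` block s & c `&` block s != fset0]) ->
     small c) ->
  small fset0 -> (exists s, block s `<=` D /\ d `<=` block s) ->
  exists c1 c2, [/\ c1 `|` c2 `<=` E, [disjoint c1 & c2],
    adjacent_closed E c1 /\ adjacent_closed E c2, small c1 /\ small c2 &
    forall s, block s `<=` D -> d `<=` block s -> block s `\` d `<=` c1 `|` c2].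
Proof.
move=> smallP small0 [s0 [s0D ds0]].
have comp s x (xE : x \in E) : block s `<=` D -> d `<=` block s ->
    x \in block s `\` d ->
    small (component_of [` xE]) /\ block s `\` d `<=` component_of [` xE].
  move=> sD ds xs.
  have xc : x \in component_of [` xE].
    by have := mem_component_of [` xE] [` xE]; rewrite /= => ->; exact: connect0.
  split; last exact: block_closed (@component_of_closed _ _) sD ds xs xc.
  apply: smallP; first exact: component_ofP.
  exists s; split => //; apply/fset0Pn; exists x; rewrite inE xc.
  by move: xs; rewrite inE => /andP[].
have inE' s x : block s `<=` D -> x \in block s `\` d -> x \in E.
  by move=> sD; rewrite !in_fsetD => /andP[-> /(fsubsetP sD)].
have [_ [_ [x0 [y0 [_ s0E _ _]]]]] := block_domino dom_d ds0.
have x0s : x0 \in block s0 `\` d by rewrite s0E fset21.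
have x0E := inE' _ _ s0D x0s.
have [sm1 sub1] := comp _ _ x0E s0D ds0 x0s.
set c1 := component_of _ in sm1 sub1.
(* Either some block leaves [c1] and provides a second component, beyond which [domino_blocks]
   leaves no further block, or [c1] suffices and the second set is empty. *)
have [[s1 [x1 [s1D ds1 x1s x1c]]]|none] := pselect (exists s x,
    [/\ block s `<=` D, d `<=` block s, x \in block s `\` d & x \notin c1]).
  have x1E := inE' _ _ s1D x1s.
  have [sm2 sub2] := comp _ _ x1E s1D ds1 x1s.
  exists c1, (component_of [` x1E]); split; last 1 first.
  - move=> s sD ds; have /or3P[] := domino_blocks dom_d ds0 ds1 ds.
    + by move=> /eqP s01; case/negP: x1c; apply: (fsubsetP sub1); rewrite s01.
    + by move=> /eqP ->; apply: fsubset_trans sub1 (fsubsetUl _ _).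
    + by move=> /eqP ->; apply: fsubset_trans sub2 (fsubsetUr _ _).
  - by rewrite fsubUset !component_of_sub.
  - exact: component_of_disjoint.
  - by split; exact: component_of_closed.
  - by split.
exists c1, fset0; split.
- by rewrite fsetU0 component_of_sub.
- exact: fdisjointX0.
- by split; [exact: component_of_closed|move=> x y; rewrite inE].
- by split.
- move=> s sD ds; rewrite fsetU0; apply/fsubsetP => x xs.
  by apply/negPn/negP => xc; apply: none; exists s, x.
Qed.

(** Adjacent squares have opposite colours, and adjacency does not lead from one component to the
    other, so the colours may be exchanged on [c2] alone. *)
Lemma colour_classes_two_colouring c1 c2 :
  c1 `|` c2 `<=` E -> [disjoint c1 & c2] ->
  adjacent_closed E c1 -> adjacent_closed E c2 ->
  (forall s, block s `<=` D -> d `<=` block s -> block s `\` d `<=` c1 `|` c2) ->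
  two_colouring D d (colour_class true c1 `|` colour_class false c2)
                    (colour_class false c1 `|` colour_class true c2).
Proof.
move=> cE dis cc1 cc2 blk.
split; rewrite ?colour_classes_cover //.
- apply/fdisjointP => x; rewrite !inE.
  have : ~~ ((x \in c1) && (x \in c2)).
    by apply/negP => /andP[/(fdisjointP dis)/negP].
  by case: (x \in c1); case: (x \in c2); case: white.
- move=> x y + yE xy; rewrite !inE (white_adjacent xy).
  by move=> /orP[] /andP[xc /eqP ->]; rewrite ?(cc1 _ _ xc yE xy) ?(cc2 _ _ xc yE xy) ?orbT.
- move=> x y + yE xy; rewrite !inE (white_adjacent xy).
  by move=> /orP[] /andP[xc /eqP ->]; rewrite ?(cc1 _ _ xc yE xy) ?(cc2 _ _ xc yE xy) ?orbT.
Qed.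

End FlippableComponents.

(** * Completing a colour class to a balanced plug *)

Section BalancedPlug.
Implicit Types (A B E X : {fset square}).

Lemma subset_of_card A k : (k <= #|` A|)%N ->
  exists2 B, B `<=` A & #|` B| = k.
Proof.
move=> kA; exists [fset x in take k A].
  by apply/fsubsetP => x; rewrite inE /= => /mem_take.
rewrite card_fseq undup_id ?take_uniq ?fset_uniq // size_take.
by case: ltngtP kA.
Qed.

Lemma colour_count_class b b' A :
  colour_count b (colour_class b' A) = if b == b' then colour_count b A else 0%N.
Proof. by rewrite /colour_count colour_classK; case: eqP; rewrite ?cardfs0. Qed.

Lemma colour_count_sub_class b b' A X : X `<=` colour_class b' A ->
  colour_count b X = if b == b' then #|` X| else 0%N.
Proof.
move=> /fsubsetP XA; have XE : colour_class b' X = X.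
  apply/fsetP => x; rewrite !inE andb_idr // => /XA.
  by rewrite inE => /andP[].
by rewrite -{1}XE colour_count_class /colour_count; case: eqP => // ->; rewrite XE.
Qed.

(** With the colours exchanged on [c2], the class has an excess of w1 - b2 white squares, where wi
    and bi count the colours in [ci]. Outside the components n - b1 - b2 black squares are
    available, at least w1 - b2 because w1 + b1 is at most n; an excess of black squares is dealt
    with in the same way through [c2]. *)
Lemma balanced_extension E c1 c2 n :
  c1 `|` c2 `<=` E -> [disjoint c1 & c2] ->
  colour_count true E = n -> colour_count false E = n ->
  (#|` c1| <= n)%N -> (#|` c2| <= n)%N ->
  exists X, [/\ X `<=` E, balanced X &
    X `&` (c1 `|` c2) = colour_class true c1 `|` colour_class false c2].
Proof.
move=> cE dis tE fE.
rewrite -!colour_count_card => n1 n2.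
pose o := E `\` (c1 `|` c2).
have ot : colour_count true o = (n - (colour_count true c1 + colour_count true c2))%N.
  by rewrite colour_countD // colour_countU // tE.
have of_ : colour_count false o = (n - (colour_count false c1 + colour_count false c2))%N.
  by rewrite colour_countD // colour_countU // fE.
pose Z := colour_class true c1 `|` colour_class false c2.
have ZC : Z `<=` c1 `|` c2.
  by apply: fsetUSS; apply/fsubsetP => x; rewrite !inE => /andP[].
have Zdis : [disjoint colour_class true c1 & colour_class false c2].
  by apply/fdisjointP => x; rewrite !inE => /andP[_ /eqP ->]; rewrite andbF.
have Zt : colour_count true Z = colour_count true c1.
  by rewrite colour_countU // !colour_count_class /= addn0.
have Zf : colour_count false Z = colour_count false c2.
  by rewrite colour_countU // !colour_count_class /=.
(* The set [r] consists of squares of a single colour, the one lacking in [Z]. *)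
have [r ro rc] : exists2 r, r `<=` o & (colour_count true Z + colour_count true r =
    colour_count false Z + colour_count false r)%N.
  have monochrome b k : (k <= colour_count b o)%N -> exists2 r, r `<=` o &
      colour_count b r = k /\ colour_count (~~ b) r = 0%N.
    move=> /subset_of_card[r ro rk]; exists r.
      by apply: fsubset_trans ro _; apply/fsubsetP => x; rewrite !inE => /andP[].
    by rewrite !(colour_count_sub_class _ ro) rk eqxx; case: (b).
  rewrite Zt Zf; have [le|lt] := leqP (colour_count false c2) (colour_count true c1).
    have [|r ro [rf rt]] := monochrome false (colour_count true c1 - colour_count false c2)%N.
      by rewrite of_; lia.
    by exists r => //; rewrite rf rt; lia.
  have [|r ro [rt rf]] := monochrome true (colour_count false c2 - colour_count true c1)%N.
    by rewrite ot; lia.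
  by exists r => //; rewrite rf rt; lia.
have rC x : x \in r -> x \notin c1 `|` c2.
  by move=> /(fsubsetP ro); rewrite in_fsetD => /andP[].
exists (Z `|` r); split.
- rewrite fsubUset (fsubset_trans ZC cE) (fsubset_trans ro) //.
  exact: fsubsetDl.
- have Zr : [disjoint Z & r].
    by apply/fdisjointP => x /(fsubsetP ZC) xC; apply: contraL xC; exact: rC.
  by rewrite balancedE (colour_countU true Zr) (colour_countU false Zr) rc.
- apply/fsetP => x; rewrite in_fsetI in_fsetU.
  have [xZ|xZ] := boolP (x \in Z); first by rewrite (fsubsetP ZC).
  by apply/negbTE/negP => /andP[xr]; exact/negP/rC.
Qed.

End BalancedPlug.

(** * Assembling the homomorphism and realising both generators *)

Theorem theorem4 (R : realType) (D d : {fset square}) :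
  quadriculated_disk R D ->
  balanced D ->
  is_domino d ->
  d `<=` D ->
  disconnected (D `\` d) ->
  (exists s : square, block s `<=` D /\ d `<=` block s) ->
  (forall c : {fset square}, component (D `\` d) c ->
     (exists s : square,
        [/\ block s `<=` D, d `<=` block s & c `&` block s != fset0]) ->
     (#|` c| <= (#|` D| - 2)./2)%N) ->
  strongly_irregular D.
Proof.
move=> diskD balD dom_d dD _ blk small.
have [c1 [c2 [cE dis [cc1 cc2] [n1 n2] cblk]]] :=
  flippable_components dom_d small isT blk.
have ZZ' := colour_classes_two_colouring cE dis cc1 cc2 cblk.
move: ZZ'; set Z := _ `|` colour_class false c2; set Z' := _ `|` _ => ZZ'.
have CE : Z `|` Z' = c1 `|` c2 by exact: colour_classes_cover.
have [s0 [s0D ds0]] := blk.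
have linkedD := quadriculated_disk_linked diskD.
(* Balance and the removal of one square of each colour leave the same number [n] of squares in each
   colour, so the size bound is the one required by [balanced_extension]. *)
have counts b : colour_count b (D `\` d) = (#|` D| - 2)./2.
  have := balD; rewrite balancedE => /eqP h.
  rewrite colour_countD // (colour_count_domino b dom_d) -(colour_count_card D).
  by move: h; case: b; lia.
have realise X : X `<=` D `\` d -> balanced X -> exists g : even_domino_group D,
    even_label d Z Z' g = label d Z Z' [fset d] X.
  move=> XE bX; apply: (even_label_d balD dom_d s0D ds0 linkedD ZZ').
    by rewrite /is_plug bX (fsubset_trans XE) // fsubsetDl.
  by apply/fdisjointP => x /(fsubsetP XE); rewrite inE => /andP[].
have [X [XE bX XC]] := balanced_extension cE dis (counts true) (counts false) n1 n2.
(* Exchanging the roles of [c1] and [c2] turns [Z] into [Z']. *)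
have [X' [X'E bX' X'C]] : exists X', [/\ X' `<=` D `\` d, balanced X' &
    X' `&` (c1 `|` c2) = Z'].
  have [||X' [? ? X'C]] := balanced_extension _ _ (counts true) (counts false) n2 n1.
  - by rewrite fsetUC.
  - by rewrite fdisjoint_sym.
  - by exists X'; split => //; rewrite fsetUC X'C fsetUC.
(* Since [label] tests for [Z] first, the second generator is reached only if the classes differ;
   they are disjoint with nonempty union. *)
have ZnZ' : Z' != Z.
  have [_ [_ [x [y [_ s0E _ _]]]]] := block_domino dom_d ds0.
  have : x \in Z `|` Z' by rewrite CE (fsubsetP (cblk _ s0D ds0)) // s0E fset21.
  apply: contraTneq => ZE; have := colouring_disjoint ZZ'; rewrite ZE fsetUid.
  by move=> /fdisjointP h; apply/negP => xZ; have := h _ xZ; rewrite xZ.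
exists (even_label_hom ZZ'); apply: multiplicative_surjective => i.
have [->|i0] := eqVneq i ord0.
  have [g gX] := realise X XE bX; exists g; rewrite [LHS]gX /label fset11.
  by rewrite CE XC eqxx.
have -> : i = ord_max by apply: val_inj; case: i i0 => [[|[]]].
have [g gX] := realise X' X'E bX'; exists g; rewrite [LHS]gX /label fset11.
by rewrite CE X'C (negPf ZnZ') eqxx.
Qed.
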